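(* Let $\mu,v\in\mathbb R$, $u,c>v$, $t>0$, $n\ge1$, $0=s_0<s_1<\cdots<s_n<t$, $y_0=u$ and $y_1,\dots,y_n>v$. Then $$ P\Big\{\bigcap_{j=1}^n(B^\mu(s_j)\in\mathrm dy_j)\ \Big|\ \min_{0\le z\le t}B^\mu(z)>v,\ B^\mu(0)=u,\ B^\mu(t)=c\Big\} $$ $$ =\prod_{j=1}^n\left\{\frac{e^{-\frac{(y_j-y_{j-1})^2}{2(s_j-s_{j-1})}}-e^{-\frac{(2v-y_j-y_{j-1})^2}{2(s_j-s_{j-1})}}}{\sqrt{2\pi(s_j-s_{j-1})}}\,\mathrm dy_j\right\}\ \frac{e^{-\frac{(c-y_n)^2}{2(t-s_n)}}-e^{-\frac{(2v-c-y_n)^2}{2(t-s_n)}}}{\sqrt{2\pi(t-s_n)}}\ \left(\frac{e^{-\frac{(c-u)^2}{2t}}-e^{-\frac{(2v-c-u)^2}{2t}}}{\sqrt{2\pi t}}\right)^{-1}, $$ and the following equality in law holds: $$ B^\mu\,\Big|\,\Big\{\min_{0\le z\le t}B^\mu(z)>v,\ B^\mu(0)=u,\ B^\mu(t)=c\Big\}\ \stackrel{\text{law}}{=}\ B\,\Big|\,\Big\{\min_{0\le z\le t}B(z)>v,\ B(0)=u,\ B(t)=c\Big\}. $$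
   Context: $B$ is a standard one-dimensional Brownian motion and $B^\mu(t)=B(t)+\mu t$ is Brownian motion with drift $\mu$; conditioning on $B^\mu(0)=u$ means that the process is started at $u$. The conditional process given $\{\min_{0\le z\le t}B^\mu(z)>v,\ B^\mu(0)=u,\ B^\mu(t)=c\}$ (drifted Brownian excursion from $u$ to $c$ above $v$) is the bridge of $B^\mu$ from $u$ at time $0$ to $c$ at time $t$, conditioned on the positive-probability event that it stays strictly above $v$ on $[0,t]$; conditioning on $B^\mu(t)=c$ is understood through conditional densities. *)

(* Defs.v *)
From HB Require Import structures.
From mathcomp Require Import all_boot all_order all_algebra.
From mathcomp Require Import all_classical all_reals all_analysis.
Set Implicit Arguments.
Unset Strict Implicit.
Unset Printing Implicit Defensive.
Import Order.TTheory GRing.Theory Num.Theory.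
Import numFieldNormedType.Exports.
Local Open Scope classical_set_scope.
Local Open Scope ring_scope.

(* Integral over R^n with respect to dy_1 ... dy_n, as an iterated Lebesgue
   integral (outermost variable first).  It is only used for nonnegative
   measurable integrands, where Tonelli's theorem makes the order irrelevant. *)
Fixpoint lebesgue_intn {R : realType} (n : nat) :
    (n.-tuple R -> \bar R) -> \bar R :=
  match n return (n.-tuple R -> \bar R) -> \bar R with
  | 0 => fun f => f [tuple]
  | m.+1 => fun f =>
      (\int[lebesgue_measure]_x
         lebesgue_intn (fun y : m.-tuple R => f [tuple of x :: y]))%E
  end.

Section BrownianMotion.
Context {R : realType} d (T : measurableType d) (P : probability T R).

Record standard_brownian (B : R -> {RV P >-> R}) : Prop := {
  brownian_start : {ae P, forall w, B 0 w = 0};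
  brownian_increments_indep :
    forall (n : nat) (s : nat -> R) (A : nat -> set R),
      0 <= s 0%N -> (forall j, (j < n)%N -> s j <= s j.+1) ->
      (forall j, measurable (A j)) ->
      P (\bigcap_(j in `I_n) [set w | A j (B (s j.+1) w - B (s j) w)]) =
      (\prod_(j < n) P [set w | A j (B (s j.+1) w - B (s j) w)%R])%E;
  brownian_increments_normal :
    forall (s r : R) (A : set R), 0 <= s -> s < r -> measurable A ->
      P [set w | A (B r w - B s w)] = normal_prob 0 (Num.sqrt (r - s)) A;
  brownian_continuous :
    {ae P, forall w, {within `[0, +oo[, continuous (fun s => B s w)}} }.

(* B^mu(s) under the condition B^mu(0) = u, i.e. started at u. *)
Definition drifted (B : R -> {RV P >-> R}) (mu u : R) : R -> T -> R :=
  fun s w => u + (B s w + mu * s).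

Definition conditional_prob (A E : set T) : R :=
  fine (P (A `&` E)) / fine (P E).

(* f is the continuous version of the joint density of Z; continuity is taken
   in the usual topology of R^n (n-tuples carry no topology in the library),
   and determines f uniquely. *)
Definition continuous_density (n : nat) (Z : T -> n.-tuple R)
    (f : n.-tuple R -> R) : Prop :=
  [/\ continuous (fun z : 'rV[R]_n => f [tuple z ord0 i | i < n]),
      forall y, 0 <= f y &
      forall A : set (n.-tuple R), measurable A ->
        P (Z @^-1` A) = lebesgue_intn (fun y => (\1_A y * f y)%:E)].

End BrownianMotion.

(* 0 = s_0 < s_1 < ... < s_n < t *)
Definition time_grid {R : realType} (n : nat) (s : nat -> R) (t : R) : Prop :=
  [/\ s 0%N = 0, forall j, (j < n)%N -> s j < s j.+1 & s n < t].

Definition sample {R : realType} {T : Type} (X : R -> T -> R) (n : nat)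
    (s : nat -> R) (w : T) : n.-tuple R := [tuple X (s j.+1) w | j < n].

(* X is the process W, started at u, conditioned on W(t) = c in the sense of
   conditional densities: the density of (X(s_1), ..., X(s_n)) at y is
   f(y, c) / g(c), where f is the density of (W(s_1), ..., W(s_n), W(t)) and
   g that of W(t).  Both are taken continuous, so that their values at the
   given point c are meaningful. *)
Record is_bridge {R : realType} d (T : measurableType d) (P : probability T R)
    (W : R -> T -> R) (u t c : R) d' (T' : measurableType d')
    (P' : probability T' R) (X : R -> {RV P' >-> R}) : Prop := {
  bridge_continuous :
    forall w, {within `[0, t], continuous (fun s => X s w)};
  bridge_start : {ae P', forall w, X 0 w = u};
  bridge_end : {ae P', forall w, X t w = c};
  bridge_density :
    forall (n : nat) (s : nat -> R), time_grid n s t ->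
    forall (f : n.+1.-tuple R -> R) (g : 1.-tuple R -> R),
      continuous_density P (fun w => [tuple of rcons (sample W n s w) (W t w)])
        f ->
      continuous_density P (fun w => [tuple W t w]) g ->
    forall A : set (n.-tuple R), measurable A ->
      P' [set w | A (sample (fun r => X r : T' -> R) n s w)] =
      lebesgue_intn
        (fun y : n.-tuple R =>
           (\1_A y * (f [tuple of rcons y c] / g [tuple c]))%:E) }.

(* For a continuous path the infimum over [0, t] is attained, hence is the
   minimum. *)
Definition path_min {R : realType} (t : R) (x : R -> R) : R :=
  inf (x @` `[0, t]).

Definition above {R : realType} {T : Type} (X : R -> T -> R) (v t : R) :
    set T := [set w | v < path_min t (fun s => X s w)].

(* Sigma-algebra on paths generated by the evaluations at times in [0, t]: its
   events depend only on the restriction of the path to [0, t], and its trace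
   on continuous paths is the Borel sigma-algebra of C[0, t]. *)
Definition path_events {R : realType} (t : R) : set (set (R -> R)) :=
  <<s [set A | exists s : R, exists C : set R,
         [/\ 0 <= s <= t, measurable C & A = [set x | C (x s)]]] >>.

Definition conditional_law {R : realType} d (T : measurableType d)
    (P : probability T R) (X : R -> T -> R) (E : set T) (A : set (R -> R)) : R :=
  conditional_prob P [set w | A (fun s => X s w)] E.

Definition killed_density {R : realType} (v r x y : R) : R :=
  (expR (- (y - x) ^+ 2 / (2 * r)) - expR (- (2 * v - y - x) ^+ 2 / (2 * r)))
  / Num.sqrt (2 * pi * r).

(* In the product y_0 = u and y_j is the j-th entry of the sequence u :: y. *)
Definition excursion_density {R : realType} (v u c t : R) (n : nat)
    (s : nat -> R) (y : n.-tuple R) : R :=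
  (\prod_(j < n)
     killed_density v (s j.+1 - s j) (nth 0 (u :: y) j) (nth 0 (u :: y) j.+1))
  * killed_density v (t - s n) (nth 0 (u :: y) n) c
  * (killed_density v t u c)^-1.

(* Main.v *)
Require Import Defs.
From HB Require Import structures.
From mathcomp Require Import all_boot all_order all_algebra.
From mathcomp Require Import all_classical all_reals all_analysis.
From mathcomp Require Import measurable_realfun ring lra.
Import Order.TTheory GRing.Theory Num.Theory.
Import numFieldNormedType.Exports.
Local Open Scope classical_set_scope.
Local Open Scope ring_scope.

Set Implicit Arguments.
Unset Strict Implicit.
Unset Printing Implicit Defensive.

(** The drift disappears when the endpoint is fixed.  The joint density of
    drifted Brownian motion at the times of a grid is the driftless one
    multiplied by exp (mu (W(t) - u) - mu^2 t / 2), which depends on the path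
    only through W(t); so this factor cancels in the ratio of densities that
    defines the bridge ([path_density_heat_drift], [bridge_law]).  It remains
    to condition a Brownian bridge on staying above v.

    No stopping time is used for the reflection principle: it is replaced by a
    comparison of two kernels.  Write p_h for the heat kernel and let
      q^v_h(x, y) = p_h(x, y) (1 - exp (- 2 (x - v)^+ (y - v)^+ / h)),
    which is the killed density of the statement when x, y >= v and vanishes
    otherwise ([absorbedE], [absorbed_out]).  The method of images shows that
    q^v satisfies the Chapman-Kolmogorov equation
    ([integral_absorbed_absorbed]), so the mass of an event at the times of a
    grid, computed with q^v along the grid, does not change when every step of
    the grid is halved ([absorbed_mass_refine]).  On the other hand
      - q^v_h(x, y) <= p_h(x, y), with q^v_h(x, y) = 0 unless x, y > v, and
      - q^v_h(x, y) >= (1 - exp (- 2 e^2 / h)) p_h(x, y) if x, y >= v + e.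
    Along the grid halved m times, h is of order 2^-m and there are about 2^m
    factors, so the product of the factors of the second bound tends to 1.
    Hence, up to the normalisation p_t(u, c), the probability that the bridge
    satisfies the event and is at least v + e on all the refined grids lies
    between the masses computed with q^(v + e) and with q^v
    ([absorbed_mass_le_grids], [grids_le_absorbed_mass]).  As e decreases
    to 0, these events exhaust the event that the minimum is above v, because
    paths are continuous and the grids are dense ([path_min_gtP]), and monotone
    convergence makes the two bounds meet ([excursion_mass]).  Dividing by the
    same identity for the sure event gives the conditional density.

    The mass so obtained does not mention mu.  The path events on which two
    bridges with different drifts have the same conditional probability form a
    Dynkin system that contains all cylinders, hence all path events
    ([bridges_eq_in_law]). *)

(** * Iterated Lebesgue integrals *)

Section iterated_integral.
Context {R : realType}.
Local Open Scope ereal_scope.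
Local Notation leb := (@lebesgue_measure R).

Lemma measurable_fun_thead n :
  measurable_fun [set: n.+1.-tuple R] (fun y => thead y).
Proof. exact: measurable_tnth. Qed.

Lemma measurable_cons_pair n :
  measurable_fun setT (fun p : R * n.-tuple R => [tuple of p.1 :: p.2]).
Proof. exact: measurable_cons. Qed.

Lemma measurable_fun_consr n (f : n.+1.-tuple R -> \bar R) (x : R) :
  measurable_fun setT f -> measurable_fun setT (fun y : n.-tuple R => f [tuple of x :: y]).
Proof.
move=> mf; apply: (measurableT_comp mf).
by apply: measurable_cons => //; exact: measurable_id.
Qed.

Lemma lebesgue_intn_ge0 n (f : n.-tuple R -> \bar R) :
  (forall y, 0 <= f y) -> 0 <= lebesgue_intn f.
Proof.
elim: n f => [|n IHn] f f0 /=; first exact: f0.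
by apply: integral_ge0 => x _; apply: IHn.
Qed.

(** The parameter space is arbitrary because the induction enlarges it: the
    outermost variable of integration becomes a parameter of the inner
    integral. *)
Lemma measurable_lebesgue_intn_param d (D : measurableType d) n
    (f : D * n.-tuple R -> \bar R) :
  measurable_fun setT f -> (forall z, 0 <= f z) ->
  measurable_fun setT (fun a : D => lebesgue_intn (fun y => f (a, y))).
Proof.
elim: n d D f => [|n IHn] d D f mf f0 /=.
  by apply: (measurableT_comp mf); exact: measurable_fun_pair.
pose g (q : (D * R)%type * n.-tuple R) := f (q.1.1, [tuple of q.1.2 :: q.2]).
have mg : measurable_fun setT g.
  apply: (measurableT_comp mf); apply: measurable_fun_pair.
    exact: measurableT_comp.
  by apply: measurable_cons => //; exact: measurableT_comp.
have g0 z : 0 <= g z by exact: f0.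
have := IHn _ _ _ mg g0.
move=> /(measurable_fun_fubini_tonelli_F (m2 := leb)); apply => z.
by apply: lebesgue_intn_ge0 => y; exact: g0.
Qed.

Lemma measurable_lebesgue_intn_cons n (f : n.+1.-tuple R -> \bar R) :
  measurable_fun setT f -> (forall z, 0 <= f z) ->
  measurable_fun setT
    (fun x : R => lebesgue_intn (fun y => f [tuple of x :: y])).
Proof.
move=> mf f0.
apply: (@measurable_lebesgue_intn_param _ R n
  (fun p => f [tuple of p.1 :: p.2])) => //.
apply: (measurableT_comp mf).
exact: measurable_cons_pair.
Qed.

Lemma ge0_le_lebesgue_intn n (f g : n.-tuple R -> \bar R) :
  measurable_fun setT f -> measurable_fun setT g ->
  (forall y, 0 <= f y) -> (forall y, f y <= g y) ->
  lebesgue_intn f <= lebesgue_intn g.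
Proof.
elim: n f g => [|n IHn] f g mf mg f0 fg /=; first exact: fg.
have g0 y : 0 <= g y by exact: le_trans (fg y).
apply: ge0_le_integral => //.
- by move=> x _; exact: lebesgue_intn_ge0.
- exact: measurable_lebesgue_intn_cons.
- exact: measurable_lebesgue_intn_cons.
- by move=> x _; apply: IHn => //; exact: measurable_fun_consr.
Qed.

Lemma ge0_lebesgue_intnZl n (f : n.-tuple R -> \bar R) (k : R) :
  (0 <= k)%R -> measurable_fun setT f -> (forall y, 0 <= f y) ->
  lebesgue_intn (fun y => k%:E * f y) = k%:E * lebesgue_intn f.
Proof.
move=> k0; elim: n f => [|n IHn] f mf f0 //=.
rewrite -ge0_integralZl_EFin//.
- by apply: eq_integral => x _; rewrite IHn//; exact: measurable_fun_consr.
- by move=> x _; exact: lebesgue_intn_ge0.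
- exact: measurable_lebesgue_intn_cons.
Qed.

Lemma lebesgue_intn_nneseries n (f : nat -> n.-tuple R -> \bar R) :
  (forall k, measurable_fun setT (f k)) -> (forall k y, 0 <= f k y) ->
  lebesgue_intn (fun y => \sum_(k <oo) f k y) =
  \sum_(k <oo) lebesgue_intn (f k).
Proof.
elim: n f => [|n IHn] f mf f0 //=.
rewrite -integral_nneseries//.
- apply: eq_integral => x _; rewrite IHn// => k.
  exact: measurable_fun_consr.
- by move=> k; exact: measurable_lebesgue_intn_cons.
- by move=> k x _; exact: lebesgue_intn_ge0.
Qed.

Lemma cvg_lebesgue_intn n (f : nat -> n.-tuple R -> \bar R)
    (g : n.-tuple R -> \bar R) :
  (forall k, measurable_fun setT (f k)) -> (forall k y, 0 <= f k y) ->
  (forall y, nondecreasing_seq (f ^~ y)) ->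
  (forall y, f k y @[k --> \oo] --> g y) ->
  lebesgue_intn (f k) @[k --> \oo] --> lebesgue_intn g.
Proof.
elim: n f g => [|n IHn] f g mf f0 ndf fg /=; first exact: fg.
have H x : lebesgue_intn (fun y : n.-tuple R => f k [tuple of x :: y])
    @[k --> \oo] --> lebesgue_intn (fun y : n.-tuple R => g [tuple of x :: y]).
  apply: IHn => [k|//|y|y]; last exact: fg.
    exact: measurable_fun_consr.
  exact: ndf.
rewrite (_ : \int[_]_x _ = \int[leb]_x (limn (fun k =>
   lebesgue_intn (fun y : n.-tuple R => f k [tuple of x :: y])))); last first.
  by apply: eq_integral => x _; apply/esym/cvg_lim.
apply: cvg_monotone_convergence => //.
- by move=> k; exact: measurable_lebesgue_intn_cons.
- by move=> k x _; exact: lebesgue_intn_ge0.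
- move=> x _ a b ab; apply: ge0_le_lebesgue_intn => //.
  + exact: measurable_fun_consr.
  + exact: measurable_fun_consr.
  + by move=> y; exact: ndf.
Qed.

Lemma eq_lebesgue_intn n (f g : n.-tuple R -> \bar R) :
  f =1 g -> lebesgue_intn f = lebesgue_intn g.
Proof. by move=> fg; congr lebesgue_intn; exact/funext. Qed.

End iterated_integral.

Section density_measure.
Context {R : realType} (n : nat) (f : n.-tuple R -> R).
Hypothesis mf : measurable_fun setT f.
Hypothesis f0 : forall y, 0 <= f y.
Local Open Scope ereal_scope.

Lemma measurable_indicM (A : set (n.-tuple R)) : measurable A ->
  measurable_fun setT (fun y => (\1_A y * f y)%:E).
Proof.
by move=> mA; apply/measurable_EFinP/measurable_funM => //; exact: measurable_indic.
Qed.

Lemma indicM_ge0 (A : set (n.-tuple R)) y : 0 <= (\1_A y * f y)%:E.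
Proof. by rewrite lee_fin mulr_ge0. Qed.

(** The two proofs are arguments of the definition so that the measure structure
    attached to it below can be found by unification. *)
Definition density_measure (_ : measurable_fun setT f) (_ : forall y, (0 <= f y)%R)
  (A : set (n.-tuple R)) : \bar R :=
  lebesgue_intn (fun y => (\1_A y * f y)%:E).

Local Notation nu := (density_measure mf f0).

Let nu0 : nu set0 = 0.
Proof.
rewrite /density_measure (eq_lebesgue_intn (g := fun=> 0%R%:E * 0)).
  by rewrite ge0_lebesgue_intnZl// mul0e.
by move=> y; rewrite indic0 mul0r mul0e.
Qed.

Let nu_ge0 A : 0 <= nu A.
Proof. by apply: lebesgue_intn_ge0 => y; exact: indicM_ge0. Qed.

Let nu_sigma_additive : semi_sigma_additive nu.
Proof.
move=> F mF tF mUF.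
rewrite (_ : nu (\bigcup_k F k) = \sum_(k <oo) nu (F k)).
  by apply: is_cvg_nneseries => k _ _; exact: nu_ge0.
rewrite /density_measure -lebesgue_intn_nneseries; last 2 first.
- by move=> k; exact: measurable_indicM.
- by move=> k y; exact: indicM_ge0.
apply: eq_lebesgue_intn => y.
rewrite mulrC EFinM indic_bigcup// -nneseriesZl; last first.
  by move=> k _; rewrite lee_fin.
by apply: eq_eseriesr => k _; rewrite mulrC EFinM.
Qed.

HB.instance Definition _ := isMeasure.Build _ _ _ nu nu0 nu_ge0 nu_sigma_additive.

End density_measure.

(** * Shifts and reflections of Lebesgue measure *)

Section affine_invariance.
Context {R : realType}.
Local Open Scope ereal_scope.
Local Notation leb := (@lebesgue_measure R).

Lemma lebesgue_measure_shift (a : R) (A : set R) : measurable A ->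
  pushforward leb ((fun x => x + a)%R : _ -> measurableTypeR R) A = leb A.
Proof.
move=> mA.
apply/esym/lebesgue_measure_unique => //=; first exact: measurable_funD.
move=> _ mshift [[b c]] _ <-.
rewrite /pushforward (_ : _ @^-1` _ = `](b - a)%R, (c - a)%R]%classic); last first.
  by apply/seteqP; split => x /=; rewrite !in_itv/= ltrBlDr lerBrDr.
rewrite !lebesgue_measure_itv/= !lte_fin ltrD2r.
by case: ifPn => // _; rewrite -!EFinB; congr EFin; ring.
Qed.

Lemma ge0_integral_shift (a : R) (f : R -> \bar R) :
  measurable_fun [set: R] f -> (forall x, 0 <= f x) ->
  \int[leb]_x f (x + a)%R = \int[leb]_x f x.
Proof.
move=> mf f0; have mshift : measurable_fun [set: R]
    ((fun x => x + a)%R : R -> measurableTypeR R) by exact: measurable_funD.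
rewrite -[RHS](@eq_measure_integral _ _ _ _ _ (pushforward leb
   ((fun x => x + a)%R : _ -> measurableTypeR R))); last first.
  by move=> A mA _; exact: lebesgue_measure_shift.
by rewrite ge0_integral_pushforward.
Qed.

Lemma ge0_integral_opp (f : R -> \bar R) :
  measurable_fun [set: R] f -> (forall x, 0 <= f x) ->
  \int[leb]_x f (- x)%R = \int[leb]_x f x.
Proof.
move=> mf f0; rewrite -[RHS](@eq_measure_integral _ _ _ _ _ (pushforward leb
   (-%R : _ -> measurableTypeR R))); last first.
  by move=> A mA _; exact: lebesgue_measureN.
by rewrite ge0_integral_pushforward.
Qed.

Lemma ge0_integral_reflect (a : R) (f : R -> \bar R) :
  measurable_fun [set: R] f -> (forall x, 0 <= f x) ->
  \int[leb]_x f (a - x)%R = \int[leb]_x f x.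
Proof.
move=> mf f0; rewrite -[RHS](ge0_integral_shift a)//.
rewrite -[RHS]ge0_integral_opp//.
  by apply: eq_integral => x _; rewrite addrC.
by apply: (measurableT_comp mf); exact: measurable_funD.
Qed.

(** The half-lines on both sides of w are exchanged by the reflection
    x |-> 2 w - x, and w itself is a null set. *)
Lemma ge0_integral_fold (w : R) (f : R -> \bar R) :
  measurable_fun [set: R] f -> (forall x, 0 <= f x) ->
  \int[leb]_(x in `]w, +oo[) (f x + f (2 * w - x)%R) = \int[leb]_x f x.
Proof.
move=> mf f0.
have mfr : measurable_fun [set: R] (fun x => f (2 * w - x)%R).
  by apply: (measurableT_comp mf); exact: measurable_funB.
rewrite ge0_integralD//; [|exact: measurable_funTS..].
have -> : \int[leb]_(x in `]w, +oo[) f (2 * w - x)%R =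
    \int[leb]_(x in `]-oo, w[) f x.
  rewrite [RHS]integral_mkcond -[RHS](ge0_integral_reflect (2 * w)).
  - rewrite integral_mkcond; apply: eq_integral => x _.
    rewrite /patch !mem_setE !in_itv/= andbT; congr (if _ then _ else _).
    by apply/idP/idP => ?; lra.
  - by apply/(measurable_restrictT _ _).1 => //; exact: measurable_funTS.
  - by move=> x; apply: erestrict_ge0.
rewrite -[in RHS](setUv `]w, +oo[%classic) setCitvr ge0_integral_setU//=.
- congr (_ + _); rewrite -integral_itv_bndo_bndc//.
  by apply/measurable_funTS.
- by rewrite -setCitvr setUv.
- by apply/disj_setPS => y [/=]; rewrite !in_itv/= andbT => /lt_geF ->.
Qed.

End affine_invariance.

(** * The heat kernel and its absorbed version *)

Section gaussian_kernel.
Context {R : realType}.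
Implicit Types h x y z v : R.
Local Notation leb := (@lebesgue_measure R).

Definition heat h x y : R :=
  expR (- (y - x) ^+ 2 / (2 * h)) / Num.sqrt (2 * pi * h).

Lemma sqrt_heat_gt0 h : 0 < h -> 0 < Num.sqrt (2 * pi * h).
Proof. by move=> h0; rewrite sqrtr_gt0 !mulr_gt0// pi_gt0. Qed.

Lemma heat_ge0 h x y : 0 <= heat h x y.
Proof. by rewrite /heat divr_ge0// ?expR_ge0 ?sqrtr_ge0. Qed.

Lemma heat_gt0 h x y : 0 < h -> 0 < heat h x y.
Proof. by move=> h0; rewrite divr_gt0 ?expR_gt0 ?sqrt_heat_gt0. Qed.

Lemma heatE h x y : 0 < h -> heat h x y = normal_pdf x (Num.sqrt h) y.
Proof.
move=> h0; rewrite normal_pdfE ?gt_eqF ?sqrtr_gt0//.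
rewrite /normal_peak /normal_fun sqr_sqrtr ?ltW// mulrC /heat.
by rewrite -[h *+ 2]mulr_natl -[(h * pi) *+ 2]mulr_natl mulrA (mulrAC 2 h) mulrC.
Qed.

Lemma integral_heat h x : 0 < h -> (\int[leb]_y (heat h x y)%:E = 1)%E.
Proof.
move=> h0; under eq_integral do rewrite heatE//.
exact: integral_normal_pdf.
Qed.

Lemma measurable_heat h d (D : measurableType d) (f g : D -> R) :
  measurable_fun setT f -> measurable_fun setT g ->
  measurable_fun setT (fun a => heat h (f a) (g a)).
Proof.
move=> mf mg; rewrite /heat.
apply: measurable_funM => //; apply: measurableT_comp => //.
apply: measurable_funM => //; apply: measurableT_comp => //.
by apply: measurable_funX; exact: measurable_funB.
Qed.

(** Completing the square: a Gaussian bridge of length h is, at its midpoint,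
    Gaussian with variance h / 4 around the midpoint of the endpoints. *)
Lemma heat_midpoint h x y z : 0 < h ->
  heat (h / 2) x y * heat (h / 2) y z =
  heat (h / 4) ((x + z) / 2) y * heat h x z.
Proof.
move=> h0; rewrite /heat mulrACA -expRD [RHS]mulrACA -expRD -!invfM.
congr (expR _ / _); first by field; rewrite gt_eqF.
rewrite -!sqrtrM ?mulr_ge0 ?invr_ge0 ?ltW ?pi_gt0//.
by congr Num.sqrt; field.
Qed.

Lemma integral_heat_heat h x z : 0 < h ->
  (\int[leb]_y (heat (h / 2) x y * heat (h / 2) y z)%:E = (heat h x z)%:E)%E.
Proof.
move=> h0; under eq_integral do rewrite heat_midpoint// mulrC EFinM.
rewrite ge0_integralZl_EFin//.
- by rewrite integral_heat ?mule1// divr_gt0.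
- by move=> y _; rewrite lee_fin heat_ge0.
- by apply/measurable_EFinP; exact: measurable_heat.
- exact: heat_ge0.
Qed.

(** The positive parts extend the killed density by 0 below v, which makes the
    kernel continuous and antitone in v everywhere. *)
Definition absorbed v h x y : R :=
  heat h x y *
  (1 - expR (- (2 * Num.max (x - v) 0 * Num.max (y - v) 0 / h))).

Lemma absorbed_factor_ge0 v h x y : 0 < h ->
  0 <= 1 - expR (- (2 * Num.max (x - v) 0 * Num.max (y - v) 0 / h)).
Proof.
move=> h0; rewrite subr_ge0 -[leRHS]expR0 ler_expR oppr_le0.
by rewrite !mulr_ge0 ?invr_ge0 ?(ltW h0)// le_max lexx orbT.
Qed.

Lemma absorbed_ge0 v h x y : 0 < h -> 0 <= absorbed v h x y.
Proof. by move=> h0; rewrite mulr_ge0 ?heat_ge0 ?absorbed_factor_ge0. Qed.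

Lemma absorbed_le_heat v h x y : absorbed v h x y <= heat h x y.
Proof. by rewrite ler_piMr ?heat_ge0// gerBl expR_ge0. Qed.

Lemma absorbed_out v h x y : (x <= v) || (y <= v) -> absorbed v h x y = 0.
Proof.
rewrite /absorbed -!(subr_le0 v) => /orP[] /max_idPr ->;
by rewrite !(mulr0, mul0r) oppr0 expR0 subrr mulr0.
Qed.

(** Twice the product of the distances to v is the difference of
    (2 v - y - x)^2 / 2 and (y - x)^2 / 2, so that the second factor of the
    absorbed kernel subtracts the image charge. *)
Lemma absorbedE v h x y : 0 < h -> v <= x -> v <= y ->
  absorbed v h x y = killed_density v h x y.
Proof.
move=> h0 vx vy; rewrite /absorbed /killed_density /heat.
rewrite !max_l ?subr_ge0// mulrBr mulr1 mulrBl; congr (_ - _).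
rewrite mulrAC -expRD; congr (expR _ / _).
by field; rewrite gt_eqF.
Qed.

Lemma killed_densityE v h x y :
  killed_density v h x y = heat h x y - heat h x (2 * v - y).
Proof. by rewrite /killed_density mulrBl. Qed.

Lemma measurable_absorbed v h d (D : measurableType d) (f g : D -> R) :
  measurable_fun setT f -> measurable_fun setT g ->
  measurable_fun setT (fun a => absorbed v h (f a) (g a)).
Proof.
move=> mf mg; apply: measurable_funM; first exact: measurable_heat.
apply: measurable_funB => //; apply: measurableT_comp => //.
apply: measurableT_comp => //; apply: measurable_funM => //.
apply: measurable_funM => //; first apply: measurable_funM => //.
- by apply: measurable_maxr => //; exact: measurable_funB.
- by apply: measurable_maxr => //; exact: measurable_funB.
Qed.

Lemma absorbed_antitone v w h x y : 0 < h -> v <= w ->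
  absorbed w h x y <= absorbed v h x y.
Proof.
move=> h0 vw; rewrite ler_wpM2l ?heat_ge0// lerB// ler_expR lerN2.
rewrite ler_pM2r ?invr_gt0// -!mulrA ler_pM2l//.
by apply: ler_pM; rewrite ?ge_max !le_max ?lerB ?lexx ?orbT.
Qed.

Lemma absorbed_ge v h dlt x y : 0 < h -> 0 <= dlt -> v + dlt <= x -> v + dlt <= y ->
  (1 - expR (- (2 * dlt ^+ 2 / h))) * heat h x y <= absorbed v h x y.
Proof.
move=> h0 d0 dx dy; rewrite mulrC ler_wpM2l ?heat_ge0//.
rewrite lerB// ler_expR lerN2 ler_pM2r ?invr_gt0// -mulrA ler_pM2l// expr2.
by rewrite ler_pM// le_max lerBrDl ?dx ?dy.
Qed.

(** The method of images.  For y > v the product of the two killed densities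
    expands as a(y) + a(2 v - y) - b(y) - b(2 v - y), where a is the integrand of
    the Chapman-Kolmogorov equation of the heat kernel from x to z and b the one
    from x to the mirror image of z.  Folding the line at v turns the integral
    over the half-line into the integral of a - b over the whole line. *)
Lemma integral_absorbed_absorbed v h x z : 0 < h ->
  (\int[leb]_y (absorbed v (h / 2) x y * absorbed v (h / 2) y z)%:E =
   (absorbed v h x z)%:E)%E.
Proof.
move=> h0; have h20 : 0 < h / 2 by rewrite divr_gt0.
have [/orP xz|] := boolP ((x <= v) || (z <= v)).
  rewrite (absorbed_out h); last exact/orP.
  apply: integral0_eq => y _.
  case: xz => ?; first by rewrite absorbed_out ?mul0r//; apply/orP; left.
  by rewrite (absorbed_out _ (y := z)) ?mulr0//; apply/orP; right.
rewrite negb_or -!ltNge => /andP[vx vz].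
pose a y : R := heat (h / 2) x y * heat (h / 2) y z.
pose b y : R := heat (h / 2) x y * heat (h / 2) y (2 * v - z).
have a0 y : (0 <= (a y)%:E)%E by rewrite lee_fin mulr_ge0 ?heat_ge0.
have b0 y : (0 <= (b y)%:E)%E by rewrite lee_fin mulr_ge0 ?heat_ge0.
have ma : measurable_fun setT (fun y => (a y)%:E).
  by apply/measurable_EFinP/measurable_funM; exact: measurable_heat.
have mb : measurable_fun setT (fun y => (b y)%:E).
  by apply/measurable_EFinP/measurable_funM; exact: measurable_heat.
have mbr : measurable_fun setT (fun y => (b (2 * v - y))%:E).
  by apply: (measurableT_comp mb); exact: measurable_funB.
pose q y : R := absorbed v (h / 2) x y * absorbed v (h / 2) y z.
have q0 y : (0 <= (q y)%:E)%E by rewrite lee_fin mulr_ge0 ?absorbed_ge0.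
have mq : measurable_fun setT (fun y => (q y)%:E).
  by apply/measurable_EFinP/measurable_funM; exact: measurable_absorbed.
have intq : (\int[leb]_y (q y)%:E = \int[leb]_(y in `]v, +oo[) (q y)%:E)%E.
  rewrite [RHS]integral_mkcond; apply: eq_integral => y _.
  rewrite /patch mem_setE in_itv/= andbT; case: ltP => // yv.
  by rewrite /q absorbed_out ?mul0r// yv orbT.
(* The subtracted term is moved to the left: all integrands are nonnegative. *)
have : (\int[leb]_y (q y)%:E + \int[leb]_y (b y)%:E = \int[leb]_y (a y)%:E)%E.
  rewrite intq -(ge0_integral_fold v mb)// -(ge0_integral_fold v ma)//.
  rewrite -ge0_integralD//=.
  - apply: eq_integral => y; rewrite inE/= in_itv/= andbT => vy.
    rewrite -!EFinD; congr EFin.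
    rewrite /q !absorbedE ?ltW// !killed_densityE /a /b.
    have e1 : heat (h / 2) (2 * v - y) z = heat (h / 2) y (2 * v - z).
      by rewrite /heat; congr (expR _ / _); ring.
    have e2 : heat (h / 2) (2 * v - y) (2 * v - z) = heat (h / 2) y z.
      by rewrite /heat; congr (expR _ / _); ring.
    by rewrite e1 e2; ring.
  - exact: measurable_funTS.
  - by move=> y _; rewrite adde_ge0.
  - by apply: emeasurable_funD; exact: measurable_funTS.
rewrite !integral_heat_heat//.
rewrite absorbedE ?ltW// killed_densityE EFinB => <-.
by rewrite addeK.
Qed.

End gaussian_kernel.

(** * Densities along a time grid *)

Section path_density.
Context {R : realType}.
Implicit Types (k : R -> R -> R -> R) (h : nat -> R) (x z v : R).
Local Notation leb := (@lebesgue_measure R).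

(** A grid is given by the durations h of its steps, so that forgetting the first
    step is a shift of h.  The positions y form a plain sequence, to which a
    fixed endpoint can be appended with rcons. *)
Fixpoint path_density k h x (y : seq R) : R :=
  if y is y1 :: y' then k (h 0%N) x y1 * path_density k (fun j => h j.+1) y1 y'
  else 1.

Lemma path_density_ge0 k h x y : (forall j a b, 0 <= k (h j) a b) ->
  0 <= path_density k h x y.
Proof.
elim: y h x => [|y1 y IHy] h x k0 //=.
by rewrite mulr_ge0// IHy.
Qed.

Lemma measurable_rcons n d (D : measurableType d) (f : D -> R)
    (g : D -> n.-tuple R) :
  measurable_fun setT f -> measurable_fun setT g ->
  measurable_fun setT (fun a => [tuple of rcons (g a) (f a)]).
Proof.
move=> mf mg; apply/measurable_fun_tnthP => i /=.
have [ltin|leni] := ltnP i n.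
  rewrite (_ : _ \o _ = fun a => tnth (g a) (Ordinal ltin)).
    exact: (measurableT_comp (measurable_tnth (Ordinal ltin))).
  apply/funext => a /=.
  by rewrite !(tnth_nth 0)/= nth_rcons size_tuple ltin.
rewrite (_ : _ \o _ = f)//; apply/funext => a /=.
rewrite (tnth_nth 0)/= nth_rcons size_tuple ltnNge leni/=.
by rewrite eqn_leq leni -ltnS ltn_ord.
Qed.

Lemma measurable_path_density k n h d (D : measurableType d) (f : D -> R)
    (g : D -> n.-tuple R) :
  (forall j, measurable_fun setT (fun p : R * R => k (h j) p.1 p.2)) ->
  measurable_fun setT f -> measurable_fun setT g ->
  measurable_fun setT (fun a => path_density k h (f a) (g a)).
Proof.
elim: n h d D f g => [|n IHn] h d D f g mk mf mg.
  rewrite (_ : (fun _ => _) = cst 1)//; apply/funext => a.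
  by rewrite (tuple0 (g a)).
rewrite (_ : (fun _ => _) = fun a => k (h 0%N) (f a) (thead (g a)) *
    path_density k (fun j => h j.+1) (thead (g a)) [tuple of behead (g a)]).
  have mt : measurable_fun setT (fun a => thead (g a)).
    exact: (measurableT_comp (@measurable_fun_thead R n) mg).
  apply: measurable_funM.
    exact: (measurableT_comp (mk 0%N) (measurable_fun_pair mf mt)).
  apply: IHn => [j|//|]; first exact: mk.
  exact: (measurableT_comp (@measurable_behead _ _ n) mg).
by apply/funext => a; rewrite [in LHS](tuple_eta (g a)).
Qed.

Lemma measurable_path_density_rcons k n h x z :
  (forall j, measurable_fun setT (fun p : R * R => k (h j) p.1 p.2)) ->
  measurable_fun setT
    (fun y : n.-tuple R => path_density k h x (rcons y z)).
Proof.
move=> mk.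
apply: (@measurable_path_density k n.+1 h _ _ (fun=> x)
  (fun y : n.-tuple R => [tuple of rcons y z])) => //.
exact: measurable_rcons.
Qed.

Definition halve_steps h : nat -> R := fun j => h j./2 / 2.

(** Entry i of a tuple of positions sits at node i.+1 of the grid, and node j.+1
    of a grid becomes node (j.+1).*2 after halving its steps; hence the index
    j.*2.+1. *)
Definition even_nodes n (y : n.*2.+1.-tuple R) : n.-tuple R :=
  [tuple nth 0 y j.*2.+1 | j < n].

Lemma even_nodes_cons n (y : n.*2.+1.-tuple R) a b :
  @even_nodes n.+1 [tuple of a :: [tuple of b :: y]] =
  [tuple of b :: even_nodes y].
Proof.
apply: eq_from_tnth => i; rewrite tnth_mktuple.
case: (unliftP ord0 i) => [j ->|->]; last by rewrite tnth0.
by rewrite tnthS tnth_mktuple.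
Qed.

Lemma measurable_even_nodes n : measurable_fun setT (@even_nodes n).
Proof.
apply/measurable_fun_tnthP => i /=.
have lti : (i.*2.+1 < n.*2.+1)%N by rewrite ltnS ltn_double.
rewrite (_ : _ \o _ = fun y => tnth y (Ordinal lti)).
  exact: measurable_tnth.
by apply/funext => y /=; rewrite tnth_mktuple (tnth_nth 0).
Qed.

(** For a kernel that satisfies the Chapman-Kolmogorov equation, the midpoints
    inserted by halving the steps can be integrated out one by one. *)
Lemma lebesgue_intn_halve_steps k n h (F : n.-tuple R -> R) x z :
  (forall s, measurable_fun setT (fun p : R * R => k s p.1 p.2)) ->
  (forall s a b, 0 < s -> 0 <= k s a b) ->
  (forall s a b, 0 < s ->
    (\int[leb]_y (k (s / 2) a y * k (s / 2) y b)%:E = (k s a b)%:E)%E) ->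
  (forall j, 0 < h j) ->
  measurable_fun setT F -> (forall y, 0 <= F y) ->
  lebesgue_intn (fun y : n.*2.+1.-tuple R => (F (even_nodes y) *
    path_density k (halve_steps h) x (rcons y z))%:E) =
  lebesgue_intn (fun y => (F y * path_density k h x (rcons y z))%:E).
Proof.
move=> mk k0 kk.
have mk1 s a : measurable_fun setT (k s a).
  exact: (measurableT_comp (mk s)
    (measurable_fun_pair (measurable_cst a) (@measurable_id _ R setT))).
have mk2 s b : measurable_fun setT (k s ^~ b).
  exact: (measurableT_comp (mk s)
    (measurable_fun_pair (@measurable_id _ R setT) (measurable_cst b))).
elim: n h F x => [|n IHn] h F x h0 mF F0;
  have k20 a b : 0 <= k (h 0%N / 2) a b by rewrite k0// divr_gt0.
  rewrite /= mulr1 EFinM -kk// -ge0_integralZl_EFin//.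
  - apply: eq_integral => y _; rewrite -EFinM mulr1; congr ((F _ * _)%:E).
    by rewrite (tuple0 (even_nodes _)).
  - by move=> y _; rewrite lee_fin mulr_ge0.
  - by apply/measurable_EFinP/measurable_funM; [exact: mk1|exact: mk2].
pose h' j := h j.+1; have h'0 j : 0 < h' j by exact: h0.
have p0 a y : 0 <= path_density k h' a y.
  by apply: path_density_ge0 => j b b'; exact: k0.
pose G y2 := lebesgue_intn (fun y : n.-tuple R =>
  (F [tuple of y2 :: y] * path_density k h' y2 (rcons y z))%:E).
have F1 y2 : measurable_fun setT (fun y : n.-tuple R => F [tuple of y2 :: y]).
  apply: (measurableT_comp mF).
  by apply: measurable_cons => //; exact: measurable_id.
have G0 y2 : (0 <= G y2)%E.
  apply: lebesgue_intn_ge0 => y.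
  by rewrite lee_fin mulr_ge0.
have mG : measurable_fun setT G.
  apply: (@measurable_lebesgue_intn_param _ _ R n (fun p =>
    (F [tuple of p.1 :: p.2] * path_density k h' p.1 (rcons p.2 z))%:E)).
    apply/measurable_EFinP/measurable_funM.
      by apply: (measurableT_comp mF); exact: measurable_cons_pair.
    apply: (@measurable_path_density k n.+1 h' _ _ fst
      (fun p : R * n.-tuple R => [tuple of rcons p.2 z])) => //.
    exact: measurable_rcons.
  by move=> y; rewrite lee_fin mulr_ge0.
transitivity (\int[leb]_y1 \int[leb]_y2
    ((k (h 0%N / 2) x y1 * k (h 0%N / 2) y1 y2)%:E * G y2))%E.
  rewrite -[LHS]/(\int[leb]_y1 \int[leb]_y2 lebesgue_intn
    (fun y : n.*2.+1.-tuple R =>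
      (F (@even_nodes n.+1 [tuple of y1 :: [tuple of y2 :: y]]) *
       (k (h 0%N / 2) x y1 * (k (h 0%N / 2) y1 y2 *
        path_density k (halve_steps h') y2 (rcons y z))))%:E))%E.
  apply: eq_integral => y1 _; apply: eq_integral => y2 _.
  rewrite /G -(IHn h' (fun y => F [tuple of y2 :: y]) y2)//.
  rewrite -ge0_lebesgue_intnZl.
  - apply: eq_lebesgue_intn => y; rewrite even_nodes_cons -EFinM.
    congr EFin; rewrite [LHS]mulrC -!mulrA; congr (_ * (_ * _)).
    by rewrite mulrC.
  - by rewrite mulr_ge0.
  - apply/measurable_EFinP/measurable_funM.
      by apply: (measurableT_comp (F1 y2)); exact: measurable_even_nodes.
    exact: measurable_path_density_rcons.
  - move=> y; rewrite lee_fin mulr_ge0// path_density_ge0// => j a b.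
    by rewrite k0// divr_gt0// h0.
transitivity (\int[leb]_y2 \int[leb]_y1
    ((k (h 0%N / 2) x y1 * k (h 0%N / 2) y1 y2)%:E * G y2))%E.
  apply: (fubini_tonelli (m1 := leb) (m2 := leb) (fun p : R * R =>
    ((k (h 0%N / 2) x p.1 * k (h 0%N / 2) p.1 p.2)%:E * G p.2)%E)).
    apply: emeasurable_funM.
      apply/measurable_EFinP/measurable_funM; last exact: mk.
      exact: (measurableT_comp (mk1 _ _) measurable_fst).
    exact: (measurableT_comp mG measurable_snd).
  by move=> p; rewrite mule_ge0// lee_fin mulr_ge0.
apply: eq_integral => y2 _ /=.
under eq_integral do rewrite muleC.
rewrite ge0_integralZl//.
- rewrite kk// muleC -ge0_lebesgue_intnZl.
  + apply: eq_lebesgue_intn => y; rewrite -EFinM; congr EFin.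
    by rewrite mulrCA.
  + exact: k0.
  + by apply/measurable_EFinP/measurable_funM => //; exact: measurable_path_density_rcons.
  + by move=> y; rewrite lee_fin mulr_ge0.
- by apply/measurable_EFinP/measurable_funM; [exact: mk1|exact: mk2].
- by move=> y _; rewrite lee_fin mulr_ge0.
Qed.

Lemma path_density_absorbed_le v h x y : (forall j, 0 < h j) ->
  path_density (absorbed v) h x y <= path_density heat h x y.
Proof.
elim: y h x => [|y1 y IHy] h x h0 //=.
rewrite ler_pM ?absorbed_ge0 ?absorbed_le_heat ?IHy//.
by rewrite path_density_ge0// => j a b; exact: absorbed_ge0.
Qed.

Lemma path_density_absorbed_out v h x y z : (z \in (y : seq R)) -> z <= v ->
  path_density (absorbed v) h x y = 0.
Proof.
move=> + zv; elim: y h x => [//|y1 y IHy] h x.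
rewrite inE => /predU1P[<-|zy] /=; last by rewrite IHy// mulr0.
by rewrite absorbed_out ?mul0r// zv orbT.
Qed.

Lemma path_density_absorbed_antitone v w h x y : (forall j, 0 < h j) ->
  v <= w -> path_density (absorbed w) h x y <= path_density (absorbed v) h x y.
Proof.
move=> + vw; elim: y h x => [|y1 y IHy] h x h0 //=.
rewrite ler_pM ?absorbed_ge0 ?absorbed_antitone ?IHy//.
by rewrite path_density_ge0// => j a b; exact: absorbed_ge0.
Qed.

(** A path that keeps the distance dlt from v is hardly seen by the absorption:
    each factor loses at most exp (- 2 dlt^2 / H). *)
Lemma path_density_absorbed_ge v (dlt H : R) h x (y : seq R) :
  0 <= dlt -> (forall j, 0 < h j <= H) ->
  all (fun b => v + dlt <= b) (x :: y) ->
  (1 - expR (- (2 * dlt ^+ 2 / H))) ^+ size y * path_density heat h x y <=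
  path_density (absorbed v) h x y.
Proof.
move=> d0; elim: y h x => [|y1 y IHy] h x hH; first by rewrite expr0 mul1r.
rewrite [all _ _]/= => /andP[vx vy]; have /andP[vy1 _] := vy.
have /andP[h0 hH0] := hH 0%N; have H0 : 0 < H by exact: lt_le_trans hH0.
have eH : 0 <= 1 - expR (- (2 * dlt ^+ 2 / H)).
  rewrite subr_ge0 -[leRHS]expR0 ler_expR oppr_le0.
  by rewrite !mulr_ge0 ?sqr_ge0// invr_ge0 ltW.
rewrite [size _]/= exprS /= mulrACA; apply: ler_pM.
- by rewrite mulr_ge0 ?heat_ge0.
- by rewrite mulr_ge0 ?exprn_ge0 ?path_density_ge0// => *; exact: heat_ge0.
- apply: le_trans (absorbed_ge h0 d0 vx vy1).
  rewrite ler_wpM2r ?heat_ge0// lerB// ler_expR lerN2.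
  by rewrite ler_wpM2l ?mulr_ge0 ?sqr_ge0// lef_pV2.
- by apply: IHy => // j; exact: hH.
Qed.

Lemma cvg_absorbed (w : nat -> R) v (s x y : R) :
  w j @[j --> \oo] --> v ->
  absorbed (w j) s x y @[j --> \oo] --> absorbed v s x y.
Proof.
move=> wv; rewrite /absorbed; apply: cvgM; first exact: cvg_cst.
apply: cvgB; first exact: cvg_cst.
apply: (@cvg_comp _ _ _ _ expR); last exact: continuous_expR.
apply: cvgN; apply: cvgM; last exact: cvg_cst.
have cmax a : Num.max (a - w j) 0 @[j --> \oo] --> Num.max (a - v) 0.
  apply: (@cvg_comp _ _ _ _ (fun b : R => Num.max b 0) _ (nbhs (a - v))).
    by apply: cvgB => //; exact: cvg_cst.
  apply: (@continuous_max _ _ idfun (cst 0)); last exact: cst_continuous.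
  exact: cvg_id.
by apply: cvgM; [apply: cvgM; [exact: cvg_cst|]|].
Qed.

Lemma cvg_path_density_absorbed (w : nat -> R) v h x (y : seq R) :
  w j @[j --> \oo] --> v ->
  path_density (absorbed (w j)) h x y @[j --> \oo] -->
  path_density (absorbed v) h x y.
Proof.
move=> wv; elim: y h x => [|y1 y IHy] h x /=; first exact: cvg_cst.
by apply: cvgM; [exact: cvg_absorbed|exact: IHy].
Qed.

End path_density.

(** * From increments to positions *)

Section increments.
Context {R : realType}.
Local Notation leb := (@lebesgue_measure R).
Implicit Types (h a : nat -> R).

Definition elapsed h (j : nat) : R := \sum_(i < j) h i.

(** A kernel that is the same from every starting point: its path density is the
    product density of independent centred Gaussian increments. *)
Definition noise (s _ b : R) : R := heat s 0 b.

Definition heat_drift (mu s x y : R) : R := heat s (x + mu * s) y.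

Lemma indic_ge0 T (A : set T) x : 0 <= \1_A x :> R.
Proof. by rewrite indicE ler0n. Qed.

Lemma noise_ge0 s x y : 0 <= noise s x y.
Proof. exact: heat_ge0. Qed.

Lemma measurable_noise s :
  measurable_fun setT (fun p : R * R => noise s p.1 p.2).
Proof. exact: measurable_heat. Qed.

Lemma measurable_heat_drift mu s :
  measurable_fun setT (fun p : R * R => heat_drift mu s p.1 p.2).
Proof. by apply: measurable_heat => //; exact: measurable_funD. Qed.

Definition positions n a (x : R) (e : n.-tuple R) : n.-tuple R :=
  [tuple x + \sum_(i < j.+1) (a i + nth 0 e i) | j < n].

Lemma positions_cons n a x e1 (e : n.-tuple R) :
  positions a x [tuple of e1 :: e] =
  [tuple of (e1 + (x + a 0%N)) ::
    positions (fun j => a j.+1) (e1 + (x + a 0%N)) e].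
Proof.
apply: eq_from_tnth => i; rewrite tnth_mktuple.
case: (unliftP ord0 i) => [j ->|->].
  rewrite tnthS tnth_mktuple big_ord_recl /= !addrA.
  by congr (_ + _); ring.
by rewrite tnth0 big_ord_recl big_ord0 /= addr0; ring.
Qed.

Lemma measurable_positions n a x : measurable_fun setT (@positions n a x).
Proof.
apply/measurable_fun_tnthP => j.
rewrite (_ : _ \o _ = fun e : n.-tuple R =>
    x + \sum_(i < j.+1) (a i + nth 0 e i)); last first.
  by apply/funext => e /=; rewrite tnth_mktuple.
apply: measurable_funD => //; apply: measurable_sum => i.
apply: measurable_funD => //.
have lti : (i < n)%N by rewrite (leq_trans (ltn_ord i)).
rewrite (_ : (fun _ => _) = (@tnth n R)^~ (Ordinal lti)).
  exact: measurable_tnth.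
by apply/funext => e; rewrite (tnth_nth 0).
Qed.

(** Change of variables from positions to increments: each variable of
    integration, from the first to the last, is shifted by the previous position
    plus the drift of the step. *)
Lemma lebesgue_intn_positions n mu h (F : n.-tuple R -> R) x x0 :
  measurable_fun setT F -> (forall y, 0 <= F y) ->
  lebesgue_intn (fun y => (F y * path_density (heat_drift mu) h x y)%:E) =
  lebesgue_intn (fun e => (F (positions (fun j => mu * h j) x e) *
    path_density noise h x0 e)%:E).
Proof.
elim: n h F x x0 => [|n IHn] h F x x0 mF F0.
  by rewrite /=; congr ((F _ * _)%:E); rewrite [RHS]tuple0.
pose G (y1 : R) := lebesgue_intn (fun y : n.-tuple R => (F [tuple of y1 :: y] *
  path_density (heat_drift mu) h x [tuple of y1 :: y])%:E).
have mG : measurable_fun setT G.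
  apply: (measurable_lebesgue_intn_cons (f := fun y =>
    (F y * path_density (heat_drift mu) h x y)%:E)).
    apply/measurable_EFinP/measurable_funM => //.
    apply: measurable_path_density => // j; exact: measurable_heat_drift.
  move=> y; rewrite lee_fin mulr_ge0// path_density_ge0// => *.
  exact: heat_ge0.
have G0 y1 : (0 <= G y1)%E.
  apply: lebesgue_intn_ge0 => y; rewrite lee_fin mulr_ge0// path_density_ge0//.
  by move=> *; exact: heat_ge0.
transitivity (\int[leb]_y1 G y1)%E; first by [].
rewrite -(ge0_integral_shift (x + mu * h 0%N) mG G0).
apply: eq_integral => e1 _; rewrite /G.
set y1 := e1 + _.
transitivity (lebesgue_intn (fun y : n.-tuple R =>
    (F [tuple of y1 :: y] * heat_drift mu (h 0%N) x y1 *
     path_density (heat_drift mu) (fun j => h j.+1) y1 y)%:E)).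
  by apply: eq_lebesgue_intn => y; rewrite /= mulrA.
rewrite (IHn _ _ _ e1); last 2 first.
- apply: measurable_funM => //; apply: (measurableT_comp mF).
  by apply: measurable_cons => //; exact: measurable_id.
- by move=> y; rewrite mulr_ge0// heat_ge0.
apply: eq_lebesgue_intn => e; rewrite positions_cons -/y1 /= -mulrA.
congr ((_ * (_ * _))%:E).
by rewrite /heat_drift /noise /heat /y1 addrK subr0.
Qed.

(** Discrete Girsanov formula: expanding the squares, the drift contributes
    mu (y_j - y_(j-1)) - mu^2 h_j / 2 at each step, and the first term
    telescopes. *)
Lemma path_density_heat_drift mu h x y : (forall j, 0 < h j) ->
  path_density (heat_drift mu) h x y = path_density heat h x y *
  expR (mu * (last x y - x) - mu ^+ 2 / 2 * elapsed h (size y)).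
Proof.
rewrite /elapsed; elim: y h x => [|y1 y IHy] h x h0 /=.
  by rewrite big_ord0 subrr !mulr0 subrr expR0 mulr1.
rewrite IHy// big_ord_recl /= /heat_drift /heat.
set S := \sum_(i < _) _; set p := path_density _ _ _ _; set l := last _ _.
set s := h 0%N.
have -> : expR (- (y1 - (x + mu * s)) ^+ 2 / (2 * s)) =
   expR (- (y1 - x) ^+ 2 / (2 * s)) * expR (mu * (y1 - x) - mu ^+ 2 / 2 * s).
  rewrite -expRD; congr expR.
  by field; rewrite gt_eqF// h0.
have -> : expR (mu * (l - x) - mu ^+ 2 / 2 * (s + S)) =
   expR (mu * (y1 - x) - mu ^+ 2 / 2 * s) *
   expR (mu * (l - y1) - mu ^+ 2 / 2 * S).
  by rewrite -expRD; congr expR; ring.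
by rewrite -!mulrA; congr (_ * _); rewrite mulrCA; congr (_ * _); rewrite mulrCA.
Qed.

Definition box n (C : nat -> set R) : set (n.-tuple R) :=
  [set e | forall j : 'I_n, C j (tnth e j)].

Lemma measurable_box n (C : nat -> set R) : (forall j, measurable (C j)) ->
  measurable (@box n C).
Proof.
move=> mC; rewrite (_ : box C = \bigcap_(j in [set: 'I_n])
  ((@tnth n R)^~ j @^-1` C j)); last first.
  by apply/seteqP; split => [e H j _|e H j]; [exact: H|exact: (H j I)].
apply: fin_bigcap_measurable => // j _.
rewrite -[X in measurable X]setTI; exact: measurable_tnth.
Qed.

Lemma box_cons n (C : nat -> set R) e1 (e : n.-tuple R) :
  box C [tuple of e1 :: e] <-> C 0%N e1 /\ box (fun j => C j.+1) e.
Proof.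
split=> [H|[H0 H] j].
  split; first by have := H ord0; rewrite tnth0.
  by move=> j; have := H (lift ord0 j); rewrite tnthS.
by case: (unliftP ord0 j) => [i ->|->]; [rewrite tnthS; exact: H|rewrite tnth0].
Qed.

Lemma indic_box_cons n (C : nat -> set R) e1 (e : n.-tuple R) :
  \1_(box C) [tuple of e1 :: e] =
  \1_(C 0%N) e1 * \1_(box (fun j => C j.+1)) e :> R.
Proof.
rewrite !indicE -natrM mulnb; congr ((nat_of_bool _)%:R).
apply/idP/andP; rewrite !inE; first by move=> /box_cons.
by move=> ?; exact/box_cons.
Qed.

Lemma integral_noise s (C : set R) : 0 < s -> measurable C ->
  (\int[leb]_e (\1_C e * noise s 0 e)%:E = normal_prob 0 (Num.sqrt s) C)%E.
Proof.
move=> s0 mC; rewrite /normal_prob [RHS]integral_mkcond.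
apply: eq_integral => e _; rewrite /patch indicE /noise heatE//.
by case: ifPn => _; rewrite ?mul1r ?mul0r.
Qed.

Lemma lebesgue_intn_noise_box n h x (C : nat -> set R) :
  (forall j, 0 < h j) -> (forall j, measurable (C j)) ->
  (lebesgue_intn (fun e => (\1_(@box n C) e * path_density noise h x e)%:E) =
  \prod_(j < n) normal_prob 0 (Num.sqrt (h j)) (C j))%E.
Proof.
elim: n h x C => [|n IHn] h x C h0 mC.
  rewrite big_ord0 /= mulr1 indicE mem_set// => -[]//.
rewrite big_ord_recl /=.
transitivity (\int[leb]_e1 ((\1_(C 0%N) e1 * noise (h 0%N) 0 e1)%:E *
    \prod_(j < n) normal_prob 0 (Num.sqrt (h j.+1)) (C j.+1)))%E.
  apply: eq_integral => e1 _.
  rewrite -(IHn _ e1 _ (fun j => h0 j.+1) (fun j => mC j.+1)).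
  rewrite -ge0_lebesgue_intnZl.
  - apply: eq_lebesgue_intn => e; rewrite -EFinM; congr EFin.
    rewrite indic_box_cons.
    exact: mulrACA.
  - exact: mulr_ge0 (indic_ge0 _ _) (noise_ge0 _ _ _).
  - apply/measurable_EFinP/measurable_funM.
      apply: measurable_indic; apply: measurable_box => j; exact: mC.
    by apply: (measurable_path_density (n := n) (f := fun=> e1) (g := id)) => // j; exact: measurable_noise.
  - move=> e; rewrite lee_fin; apply: mulr_ge0 (indic_ge0 _ _) _.
    by apply: path_density_ge0 => *; exact: noise_ge0.
rewrite ge0_integralZr//.
- by rewrite integral_noise.
- apply/measurable_EFinP/measurable_funM; last exact: measurable_heat.
  by apply: measurable_indic; exact: mC.
- by move=> e _; rewrite lee_fin; exact: mulr_ge0 (indic_ge0 _ _) (noise_ge0 _ _ _).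
- by apply: prode_ge0 => j _; exact: measure_ge0.
Qed.

(** Boxes form the pi-system on which laws of tuples are compared below. *)
Lemma measurable_sub_g_sigma_box n :
  @measurable _ (n.-tuple R) `<=`
  <<s [set box C | C in [set C : nat -> set R | forall j, measurable (C j)]] >>.
Proof.
apply: smallest_sub; first exact: smallest_sigma_algebra.
rewrite (_ : \big[_/_]_(i < n) _ = \bigcup_(i in [set: 'I_n])
  preimage_set_system setT ((@tnth n R)^~ i) measurable); last first.
  by rewrite -bigcup_seq; apply: eq_bigcupl; split => // i _ /=; rewrite mem_index_enum.
move=> _ [i _ [C mC <-]]; rewrite setTI; apply: sub_sigma_algebra.
exists (fun j => if j == i :> nat then C else setT).
  by move=> j /=; case: ifP.
apply/seteqP; split => e /=.
  by move=> /(_ i); rewrite eqxx.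
by move=> Ce j; case: ifPn => // /eqP/val_inj ->.
Qed.

End increments.

(** * Finite-dimensional laws of drifted Brownian motion *)

Section elapsed.
Context {R : realType}.
Implicit Types h : nat -> R.

Lemma elapsed0 h : elapsed h 0 = 0.
Proof. by rewrite /elapsed big_ord0. Qed.

Lemma elapsedS h j : elapsed h j.+1 = elapsed h j + h j.
Proof. by rewrite /elapsed big_ord_recr. Qed.

Lemma elapsed_ltS h j : (forall i, 0 < h i) -> elapsed h j < elapsed h j.+1.
Proof. by move=> h0; rewrite elapsedS ltrDl. Qed.

Lemma elapsed_ge0 h j : (forall i, 0 < h i) -> 0 <= elapsed h j.
Proof. by move=> h0; apply: sumr_ge0 => i _; exact: ltW. Qed.

Lemma elapsed_le h i j : (forall i, 0 < h i) -> (i <= j)%N ->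
  elapsed h i <= elapsed h j.
Proof.
by move=> h0 /(homo_leq (@lexx _ _) (@le_trans _ _)); apply => k; exact/ltW/elapsed_ltS.
Qed.

End elapsed.

Section brownian_finite_dimensional_laws.
Context {R : realType} d (T : measurableType d) (P : probability T R).
Implicit Types (h : nat -> R).

Lemma eq_measure_ae (A A' : set T) : measurable A -> measurable A' ->
  {ae P, forall w, A w <-> A' w} -> P A = P A'.
Proof.
move=> mA mA' [N [mN PN AN]].
have le (C C' : set T) : measurable C -> measurable C' ->
    (forall w, ~ N w -> C w -> C' w) -> (P C <= P C')%E.
  move=> mC mC' CC'; apply: (@le_trans _ _ (P (C' `|` N))).
    apply: le_measure; rewrite ?inE//; first exact: measurableU.
    by move=> w Cw; have [Nw|Nw] := pselect (N w); [right|left; exact: CC'].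
  by rewrite measureU0.
have AA' w : ~ N w -> (A w <-> A' w).
  by move=> Nw; apply: contrapT => /AN.
by apply/eqP; rewrite eq_le; apply/andP; split; apply: le => // w /AA' [].
Qed.

Variable B : R -> {RV P >-> R}.
Hypothesis hB : standard_brownian B.

Definition increments h n (w : T) : n.-tuple R :=
  [tuple B (elapsed h j.+1) w - B (elapsed h j) w | j < n].

Lemma measurable_increments h n : measurable_fun setT (increments h n).
Proof.
apply/measurable_fun_tnthP => j.
rewrite (_ : _ \o _ = fun w => B (elapsed h j.+1) w - B (elapsed h j) w).
  by apply: measurable_funB; exact: measurable_funPT.
by apply/funext => w /=; rewrite tnth_mktuple.
Qed.

(** Both sides are finite measures that agree on boxes, by independence and
    normality of the increments. *)
Lemma law_increments h n (A : set (n.-tuple R)) :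
  (forall j, 0 < h j) -> measurable A ->
  P (increments h n @^-1` A) =
  lebesgue_intn (fun e => (\1_A e * path_density noise h 0 e)%:E).
Proof.
move=> h0 mA.
have mnoise : measurable_fun setT
    (fun e : n.-tuple R => path_density noise h 0 e).
  apply: (measurable_path_density (n := n) (f := fun=> 0) (g := id)) => //.
  by move=> j; exact: measurable_noise.
have noise0 (e : n.-tuple R) : 0 <= path_density noise h 0 e.
  by apply: path_density_ge0 => *; exact: noise_ge0.
have mincr : measurable_fun setT (increments h n) by exact: measurable_increments.
pose m1 : {measure set (n.-tuple R) -> \bar R} :=
  measure_function_pushforward__canonical__measure_function_Measure P mincr.
pose m2 : {measure set (n.-tuple R) -> \bar R} := density_measure mnoise noise0.
have m12 C : (forall j, measurable (C j)) -> m1 (box C) = m2 (box C).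
  move=> mC; rewrite [RHS](lebesgue_intn_noise_box n 0 h0 mC).
  rewrite [LHS](_ : _ = P (\bigcap_(j in `I_n)
    [set w | C j (B (elapsed h j.+1) w - B (elapsed h j) w)])).
    rewrite (brownian_increments_indep hB)//.
    - apply: eq_bigr => j _.
      have := brownian_increments_normal hB (elapsed_ge0 j h0)
        (elapsed_ltS j h0) (mC j).
      have -> : elapsed h j.+1 - elapsed h j = h j by rewrite elapsedS; ring.
      exact.
    - by rewrite elapsed0.
    - by move=> j _; rewrite ltW// elapsed_ltS.
  apply: (congr1 P); apply/seteqP; split => w /= H.
    move=> j jn; have := H (Ordinal jn); by rewrite tnth_mktuple.
  by move=> j; rewrite tnth_mktuple; apply: H => /=.
apply: (g_sigma_algebra_measure_unique
  [set box C | C in [set C : nat -> set R | forall j, measurable (C j)]]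
  _ (fun=> setT) _ _ m1 m2).
- by move=> _ [C mC <-]; exact: measurable_box.
- move=> _; exists (fun=> setT) => //=.
  by apply/seteqP; split.
- by rewrite -subTset => x _; exists 0%N.
- move=> _ _ [C mC <-] [C' mC' <-]; exists (fun j => C j `&` C' j).
    by move=> j; exact: measurableI.
  apply/seteqP; split => e /=; first by move=> H; split => j; case: (H j).
  by move=> [H H'] j; split.
- by move=> _ [C mC <-]; exact: m12.
- move=> _; rewrite -[X in (X < _)%E]/(P (increments h n @^-1` setT)).
  by rewrite preimage_setT probability_setT ltry.
- exact: measurable_sub_g_sigma_box.
Qed.

(** Almost surely B 0 = 0, so the positions are the partial sums of the
    increments. *)
Lemma law_drifted (mu u : R) h n (A : set (n.-tuple R)) :
  (forall j, 0 < h j) -> measurable A ->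
  P (sample (drifted B mu u) n (elapsed h) @^-1` A) =
  lebesgue_intn (fun y => (\1_A y * path_density (heat_drift mu) h u y)%:E).
Proof.
move=> h0 mA.
rewrite (lebesgue_intn_positions _ _ _ 0 (measurable_indic mA) (indic_ge0 A)).
set pos := positions _ _.
have mpos : measurable_fun setT (pos) by exact: measurable_positions.
have mA' : measurable (pos @^-1` A).
  by rewrite -[X in measurable X]setTI; exact: mpos.
rewrite -(law_increments h0 mA').
have mincr : measurable_fun setT (increments h n) by exact: measurable_increments.
apply: eq_measure_ae.
- rewrite -[X in measurable X]setTI.
  suff : measurable_fun setT (sample (drifted B mu u) n (elapsed h)) by exact.
  apply/measurable_fun_tnthP => j.
  rewrite (_ : _ \o _ = fun w => u + (B (elapsed h j.+1) w + mu * elapsed h j.+1)).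
    by apply: measurable_funD => //; apply: measurable_funD => //; exact: measurable_funPT.
  by apply/funext => w /=; rewrite tnth_mktuple.
- by rewrite -[X in measurable X]setTI; apply: mincr.
- have := brownian_start hB; apply: filterS => w B0.
  rewrite /preimage /=; suff -> : pos (increments h n w) = sample (drifted B mu u) n (elapsed h) w by [].
  apply: eq_from_tnth => j; rewrite !tnth_mktuple /drifted.
  have -> : \sum_(i < j.+1) (mu * h i + nth 0 (increments h n w) i) =
      \sum_(0 <= i < j.+1)
        (mu * h i + (B (elapsed h i.+1) w - B (elapsed h i) w)).
    rewrite big_mkord; apply: eq_bigr => i _; congr (_ + _).
    have lti : (i < n)%N by rewrite (leq_trans (ltn_ord i)).
    by rewrite -[nth 0 _ i]/(nth 0 _ (Ordinal lti)) -tnth_nth tnth_mktuple.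
  rewrite big_split/= telescope_sumr// elapsed0 B0 subr0 big_mkord.
  by rewrite -big_distrr/= [X in u + X]addrC.
Qed.

End brownian_finite_dimensional_laws.

(** * Finite-dimensional laws of the bridge *)

Section bridge.
Context {R : realType}.
Implicit Types (h : nat -> R).

Lemma nth_sample (T : Type) (X : R -> T -> R) n (s : nat -> R) w j :
  (j < n)%N -> nth 0 (sample X n s w) j = X (s j.+1) w.
Proof.
move=> jn; rewrite -[j]/(nat_of_ord (Ordinal jn)) -tnth_nth.
by rewrite tnth_mktuple.
Qed.

Lemma continuous_heat (V : topologicalType) (s : R) (f g : V -> R) :
  continuous f -> continuous g -> continuous (fun z => heat s (f z) (g z)).
Proof.
move=> cf cg z; apply: cvgM; last exact: cvg_cst.
apply: (@cvg_comp _ _ _ _ expR); last exact: continuous_expR.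
apply: cvgM; last exact: cvg_cst.
apply: cvgN; rewrite [X in _ --> X]expr2.
under eq_cvg do rewrite expr2.
by apply: cvgM; apply: cvgB; [exact: cg|exact: cf|exact: cg|exact: cf].
Qed.

Lemma continuous_heat_drift (V : topologicalType) (mu s : R) (f g : V -> R) :
  continuous f -> continuous g ->
  continuous (fun z => heat_drift mu s (f z) (g z)).
Proof.
move=> cf cg; apply: (continuous_heat _ cg) => z.
by apply: cvgD; [exact: cf|exact: cvg_cst].
Qed.

Lemma continuous_path_density (V : topologicalType) (I : Type) k h
    (f : V -> R) (s : seq I) (g : I -> V -> R) :
  (forall j (f g : V -> R), continuous f -> continuous g ->
    continuous (fun z => k (h j) (f z) (g z))) ->
  continuous f -> (forall i, continuous (g i)) ->
  continuous (fun z => path_density k h (f z) [seq g i z | i <- s]).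
Proof.
move=> + + cg; elim: s h f => [|i s IHs] h f ck cf z /=; first exact: cvg_cst.
apply: cvgM; first exact: (ck 0%N f (g i) cf (cg i)).
by apply: (IHs (fun j => h j.+1)) => // j; exact: ck.
Qed.

Context d (T : measurableType d) (P : probability T R).
Variable B : R -> {RV P >-> R}.
Hypothesis hB : standard_brownian B.

(** The definition of a bridge refers to continuous joint densities; this is what
    makes it applicable. *)
Lemma continuous_density_drifted (mu u : R) h n : (forall j, 0 < h j) ->
  continuous_density P (sample (drifted B mu u) n (elapsed h))
    (fun y => path_density (heat_drift mu) h u y).
Proof.
move=> h0; split.
- have := @continuous_path_density 'rV[R]_n 'I_n (heat_drift mu) h
    (fun=> u) (enum 'I_n) (fun i z => z ord0 i).
  apply.
  + by move=> j f g cf cg; exact: continuous_heat_drift.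
  + exact: cst_continuous.
  + by move=> i; exact: coord_continuous.
- by move=> y; apply: path_density_ge0 => *; exact: heat_ge0.
- by move=> A mA; exact: law_drifted.
Qed.

(** The Girsanov factors of the two densities depend on the endpoint c and on the
    duration t only; they are equal and cancel, and mu disappears. *)
Lemma bridge_law (mu u c t : R) h n d' (T' : measurableType d')
    (P' : probability T' R) (X : R -> {RV P' >-> R}) (A : set (n.-tuple R)) :
  is_bridge P (drifted B mu u) u t c X ->
  (forall j, 0 < h j) -> elapsed h n.+1 = t -> measurable A ->
  P' [set w | A (sample (fun r => X r : T' -> R) n (elapsed h) w)] =
  lebesgue_intn (fun y => (\1_A y *
    (path_density heat h u (rcons y c) / heat t u c))%:E).
Proof.
move=> hX h0 ht mA.
have t0 : 0 < t.
  rewrite -ht (le_lt_trans (elapsed_ge0 n h0))//; exact: elapsed_ltS.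
have grid : time_grid n (elapsed h) t.
  split; first exact: elapsed0.
    by move=> j _; exact: elapsed_ltS.
  by rewrite -ht elapsed_ltS.
have t1 : elapsed (fun=> t) 1 = t by rewrite elapsedS elapsed0 add0r.
have Df := continuous_density_drifted mu u n.+1 h0.
have Dg := @continuous_density_drifted mu u (fun=> t) 1 (fun=> t0).
have Zf : sample (drifted B mu u) n.+1 (elapsed h) =
  (fun w => [tuple of rcons (sample (drifted B mu u) n (elapsed h) w)
    (drifted B mu u t w)]).
  apply/funext => w; apply: eq_from_tnth => i.
  rewrite tnth_mktuple (tnth_nth 0) -[RHS]/(nth 0 (rcons
    (sample (drifted B mu u) n (elapsed h) w) (drifted B mu u t w)) i).
  rewrite nth_rcons size_tuple.
  have [lti|] := ltnP i n; first by rewrite nth_sample.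
  rewrite leq_eqVlt ltnNge -ltnS ltn_ord orbF => /eqP <-.
  by rewrite eqxx ht.
have Zg : sample (drifted B mu u) 1 (elapsed (fun=> t)) =
  (fun w => [tuple drifted B mu u t w]).
  apply/funext => w; apply: eq_from_tnth => i.
  by rewrite tnth_mktuple (ord1 i) /= t1.
rewrite Zf in Df; rewrite Zg in Dg.
rewrite (bridge_density hX grid Df Dg mA).
apply: eq_lebesgue_intn => y.
suff -> : path_density (heat_drift mu) h u [tuple of rcons y c] /
    path_density (heat_drift mu) (fun=> t) u [tuple c] =
    path_density heat h u (rcons y c) / heat t u c by [].
rewrite (path_density_heat_drift mu u _ h0).
rewrite (path_density_heat_drift mu u _ (fun=> t0)).
have -> : elapsed h (size [tuple of rcons y c]) = t by rewrite size_tuple.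
have -> : last u [tuple of rcons y c] = c by rewrite /= last_rcons.
have -> : elapsed (fun=> t) (size [tuple c]) = t by rewrite size_tuple.
have -> : path_density heat (fun=> t) u [tuple c] = heat t u c by rewrite /= mulr1.
by rewrite -mulf_div [X in _ * X]divff ?mulr1// gt_eqF// expR_gt0.
Qed.

End bridge.

(** * Refined grids and the minimum of a path *)

Section refined_grids.
Context {R : realType}.
Implicit Types (h : nat -> R).

Definition refine m h : nat -> R := iter m halve_steps h.

Definition refine_size m n : nat := iter m (fun k => k.*2.+1) n.

Lemma refine_sizeS m n : (refine_size m n).+1 = (n.+1 * 2 ^ m)%N.
Proof.
elim: m => [|m IHm] /=; first by rewrite muln1.
by rewrite -doubleS IHm expnS mulnCA mul2n.
Qed.

Lemma refine_gt0 m h : (forall j, 0 < h j) -> forall j, 0 < refine m h j.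
Proof.
by move=> h0; elim: m => [|m IHm] j //=; rewrite divr_gt0.
Qed.

Lemma refine_le m h (H : R) : (forall j, h j <= H) ->
  forall j, refine m h j <= H / 2 ^+ m.
Proof.
move=> hH; elim: m => [|m IHm] j /=; first by rewrite expr0 divr1.
by rewrite exprSr invfM mulrA ler_wpM2r ?invr_ge0//; exact: IHm.
Qed.

Lemma elapsed_halve_steps h j : elapsed (halve_steps h) j.*2 = elapsed h j.
Proof.
elim: j => [|j IHj]; first by rewrite !elapsed0.
rewrite doubleS !elapsedS IHj /halve_steps /= doubleK uphalf_double.
by field.
Qed.

Lemma elapsed_refine m n h :
  elapsed (refine m h) (refine_size m n).+1 = elapsed h n.+1.
Proof.
elim: m => [//|m IHm] /=; rewrite -IHm -[in RHS]elapsed_halve_steps.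
by rewrite -doubleS.
Qed.

Lemma elapsed_bracket h n r : 0 <= r <= elapsed h n.+1 ->
  exists2 i, (i <= n)%N & elapsed h i <= r <= elapsed h i.+1.
Proof.
elim: n => [|n IHn] /andP[r0 rn]; first by exists 0%N => //; rewrite elapsed0 r0.
have [rn'|rn'] := leP r (elapsed h n.+1).
  have [|i lei ri] := IHn; first by rewrite r0.
  by exists i => //; exact: leqW.
by exists n.+1 => //; rewrite ltW.
Qed.

(** Only the inner nodes of the grid count, since the events of interest constrain
    the path there. *)
Lemma grid_dense h (s : R) n r : (forall j, h j <= s) ->
  (forall j, 0 < h j) -> (0 < n)%N -> 0 <= r <= elapsed h n.+1 ->
  exists2 j, (j < n)%N & `|elapsed h j.+1 - r| <= s.
Proof.
move=> hs h0 n0 /elapsed_bracket[[|i] lei /andP[ir ri]].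
(* r lies in the first step, whose left end is not an inner node. *)
- exists 0%N => //; rewrite ger0_norm ?subr_ge0//.
  apply: le_trans (hs 0%N); rewrite elapsedS; lra.
- exists i => //; rewrite ler0_norm ?subr_le0//.
  apply: le_trans (hs i.+1); rewrite opprB lerBlDl -elapsedS//.
Qed.

Lemma refined_grid_dense h (H : R) n r (e : R) : (forall j, 0 < h j <= H) ->
  0 < e -> 0 <= r <= elapsed h n.+1 ->
  exists m j, (j < refine_size m n)%N /\
    `|elapsed (refine m h) j.+1 - r| < e.
Proof.
move=> hH e0 rt.
have h0 j : 0 < h j by have /andP[] := hH j.
have H0 : 0 < H by have /andP[? ?] := hH 0%N; apply: lt_le_trans (h0 0%N) _.
(* H / e < m < 2 ^ m *)
pose m := (Num.truncn (H / e)).+1.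
have Hm : H / 2 ^+ m < e.
  rewrite ltr_pdivrMr ?exprn_gt0// mulrC -ltr_pdivrMr//.
  apply: (lt_trans (truncnS_gt _)).
  by rewrite -natrX ltr_nat ltn_expl.
have := @grid_dense (refine m h) (H / 2 ^+ m) (refine_size m n) r.
case=> [||||].
- by apply: refine_le => j; have /andP[] := hH j.
- exact: refine_gt0.
- by [].
- by rewrite elapsed_refine.
- by move=> j jm jr; exists m, j; split => //; exact: le_lt_trans Hm.
Qed.

(** A continuous path is above v by some margin on the whole interval iff it is so
    on the dense set of inner nodes of the refined grids.  The margins run
    through a sequence so that the event is a countable union. *)
Lemma path_min_gtP (x : R -> R) (v t H : R) h n (e : nat -> R) :
  (forall j, 0 < h j <= H) -> elapsed h n.+1 = t ->
  {within `[0, t], continuous x} -> (forall k, 0 < e k) ->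
  e k @[k --> \oo] --> 0 ->
  v < path_min t x <-> exists k, forall m j, (j < refine_size m n)%N ->
    v + e k <= x (elapsed (refine m h) j.+1).
Proof.
move=> hH ht cx e0 ecv.
have h0 j : 0 < h j by have /andP[] := hH j.
have t0 : 0 < t.
  rewrite -ht (le_lt_trans (elapsed_ge0 n h0))//; exact: elapsed_ltS.
have grid_in m j : (j < refine_size m n)%N ->
    `[0, t]%classic (elapsed (refine m h) j.+1).
  move=> jm; rewrite /= in_itv/= elapsed_ge0; last exact: refine_gt0.
  have -> : t = elapsed (refine m h) (refine_size m n).+1.
    by rewrite elapsed_refine.
  by rewrite elapsed_le//; [exact: refine_gt0|exact: leqW].
split.
- move=> vx.
  have xlb : has_lbound (x @` `[0, t]).
    have [b _ xb] := EVT_min (ltW t0) cx.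
    by exists (x b) => _ [r r0t <-]; exact: xb.
  have [k ek] : exists k, e k < path_min t x - v.
    move/cvgrPdist_lt : ecv => /(_ (path_min t x - v)).
    rewrite subr_gt0 => /(_ vx)[k _ /(_ k (leqnn k))].
    rewrite /= sub0r normrN gtr0_norm// => ?; by exists k.
  exists k => m j jm; apply: (@le_trans _ _ (path_min t x)).
    by rewrite -lerBrDl ltW.
  by apply: ge_inf => //; exists (elapsed (refine m h) j.+1) => //; exact: grid_in.
- move=> [k xk]; apply: (@lt_le_trans _ _ (v + e k)); first by rewrite ltrDl.
  apply: lb_le_inf; first by exists (x 0), 0 => //=; rewrite in_itv/= lexx ltW.
  move=> _ [r r0t <-]; rewrite leNgt; apply/negP => xr.
  move: cx => /subspace_continuousP /(_ r r0t) cr.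
  have : \forall s \near within `[0, t]%classic (nbhs r), x s < v + e k.
    exact: (cvgr_lt _ cr).
  rewrite near_withinE => /nbhs_ballP[del /= del0 hdel].
  have [|m [j [jm]]] := @refined_grid_dense h H n r del hH del0.
    by move: r0t; rewrite /= in_itv/= ht.
  rewrite distrC => rj; have := hdel _ rj (grid_in _ _ jm).
  by rewrite ltNge (xk m j jm).
Qed.

End refined_grids.

(** * Comparison of the two kernels on one grid *)

Fixpoint refine_set {R : realType} m n (A : set (n.-tuple R)) :
    set ((refine_size m n).-tuple R) :=
  match m return set ((refine_size m n).-tuple R) with
  | 0 => A
  | m'.+1 => @even_nodes R (refine_size m' n) @^-1` @refine_set R m' n A
  end.
Arguments refine_set {R} m {n} A.

Section excursion_mass.
Context {R : realType} (u c t : R).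
Implicit Types (h : nat -> R) (v : R).

Definition absorbed_mass v n h (A : set (n.-tuple R)) : \bar R :=
  lebesgue_intn (fun y : n.-tuple R =>
    (\1_A y * path_density (absorbed v) h u (rcons y c))%:E).

Lemma measurable_path_absorbed v n h : measurable_fun setT
  (fun y : n.-tuple R => path_density (absorbed v) h u (rcons y c)).
Proof.
by apply: measurable_path_density_rcons => j; exact: measurable_absorbed.
Qed.

Lemma measurable_path_heat n h : measurable_fun setT
  (fun y : n.-tuple R => path_density heat h u (rcons y c)).
Proof.
by apply: measurable_path_density_rcons => j; exact: measurable_heat.
Qed.

Lemma path_absorbed_ge0 v h y : (forall j, 0 < h j) ->
  0 <= path_density (absorbed v) h u y.
Proof. by move=> h0; apply: path_density_ge0 => *; exact: absorbed_ge0. Qed.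

Lemma path_heat_ge0 h y : 0 <= path_density heat h u y.
Proof. by apply: path_density_ge0 => *; exact: heat_ge0. Qed.

Lemma measurable_refine_set m n (A : set (n.-tuple R)) :
  measurable A -> measurable (refine_set m A).
Proof.
move=> mA; elim: m => [//|m IHm] /=.
by rewrite -[X in measurable X]setTI; exact: measurable_even_nodes.
Qed.

Lemma absorbed_mass_refine v m n h (A : set (n.-tuple R)) :
  (forall j, 0 < h j) -> measurable A ->
  absorbed_mass v (refine m h) (refine_set m A) = absorbed_mass v h A.
Proof.
move=> h0 mA; elim: m => [//|m IHm]; rewrite -IHm.
apply: (@lebesgue_intn_halve_steps R (absorbed v) (refine_size m n)
  (refine m h) \1_(refine_set m A) u c).
- by move=> s; exact: measurable_absorbed.
- by move=> s a b s0; exact: absorbed_ge0.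
- by move=> s a b s0; exact: integral_absorbed_absorbed.
- exact: refine_gt0.
- by apply: measurable_indic; exact: measurable_refine_set.
- exact: indic_ge0.
Qed.

Lemma sample_refine T (X : R -> T -> R) m n h (A : set (n.-tuple R)) w :
  A (sample X n (elapsed h) w) <->
  refine_set m A (sample X (refine_size m n) (elapsed (refine m h)) w).
Proof.
elim: m => [//|m IHm]; rewrite IHm /=.
suff -> : even_nodes (sample X (refine_size m n).*2.+1
    (elapsed (halve_steps (refine m h))) w) =
  sample X (refine_size m n) (elapsed (refine m h)) w by [].
apply: eq_from_tnth => j; rewrite !tnth_mktuple nth_sample.
  by rewrite -doubleS elapsed_halve_steps.
by rewrite ltnS ltn_double.
Qed.

(** Lowering the barrier increases the absorbed kernel, so that monotone
    convergence applies without any domination. *)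
Lemma cvg_absorbed_mass (e : nat -> R) v n h (A : set (n.-tuple R)) :
  (forall j, 0 < h j) -> measurable A -> nonincreasing_seq e ->
  e k @[k --> \oo] --> 0 ->
  absorbed_mass (v + e k) h A @[k --> \oo] --> absorbed_mass v h A.
Proof.
move=> h0 mA e_dec e_cvg; apply: cvg_lebesgue_intn.
- by move=> k; apply: (measurable_indicM (measurable_path_absorbed _ _)).
- move=> k y; rewrite lee_fin; apply: mulr_ge0; first exact: indic_ge0.
  exact: path_absorbed_ge0.
- move=> y i j ij; rewrite lee_fin ler_wpM2l ?indic_ge0//.
  apply: path_density_absorbed_antitone => //.
  by rewrite lerD2l; exact: e_dec.
- move=> y; apply: cvg_EFin; first by near=> k.
  apply: cvgM; first exact: cvg_cst.
  apply: cvg_path_density_absorbed.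
  by rewrite -[X in _ --> X]addr0; apply: cvgD => //; exact: cvg_cst.
Unshelve. all: by end_near. Qed.

Context d (T : measurableType d) (P : probability T R).
Variable X : R -> {RV P >-> R}.
Local Notation Xf := (fun r => X r : T -> R).

(* X is only known through the finite-dimensional laws of the Brownian bridge. *)
Hypothesis t0 : 0 < t.
Hypothesis law : forall n h (A : set (n.-tuple R)),
  (forall j, 0 < h j) -> elapsed h n.+1 = t -> measurable A ->
  P [set w | A (sample Xf n (elapsed h) w)] =
  lebesgue_intn (fun y => (\1_A y *
    (path_density heat h u (rcons y c) / heat t u c))%:E).

Definition grid_above n h v : set T :=
  [set w | forall j, (j < n)%N -> v <= X (elapsed h j.+1) w].

Lemma measurable_sample n s : measurable_fun setT (sample Xf n s).
Proof.
apply/measurable_fun_tnthP => j.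
rewrite (_ : _ \o _ = X (s j.+1)); first exact: measurable_funPT.
by apply/funext => w /=; rewrite tnth_mktuple.
Qed.

Lemma measurable_sample_set n s (A : set (n.-tuple R)) :
  measurable A -> measurable [set w | A (sample Xf n s w)].
Proof.
move=> mA; rewrite -[X in measurable X]setTI.
exact: (measurable_sample s).
Qed.

Lemma grid_aboveE n h v (A : set (n.-tuple R)) :
  [set w | A (sample Xf n (elapsed h) w)] `&` grid_above n h v =
  [set w | (A `&` box (fun=> `[v, +oo[%classic)) (sample Xf n (elapsed h) w)].
Proof.
apply/seteqP; split=> w /= [Aw H]; split => //.
  by move=> j; rewrite tnth_mktuple/= in_itv/= andbT; exact: H.
move=> j jn; have := H (Ordinal jn).
by rewrite tnth_mktuple/= in_itv/= andbT.
Qed.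

Lemma heat_mass n h (A : set (n.-tuple R)) :
  (forall j, 0 < h j) -> elapsed h n.+1 = t -> measurable A ->
  ((heat t u c)%:E * P [set w | A (sample Xf n (elapsed h) w)])%E =
  lebesgue_intn (fun y => (\1_A y * path_density heat h u (rcons y c))%:E).
Proof.
move=> h0 ht mA; rewrite law// -ge0_lebesgue_intnZl ?heat_ge0//.
- apply: eq_lebesgue_intn => y; rewrite -EFinM; congr EFin.
  by rewrite mulrCA [X in _ * X]mulrC divfK// gt_eqF// heat_gt0.
- apply: measurable_indicM => //; apply: measurable_funM => //.
  exact: measurable_path_heat.
- move=> y; rewrite lee_fin mulr_ge0 ?indic_ge0// divr_ge0 ?heat_ge0//.
  exact: path_heat_ge0.
Qed.

Lemma measurable_ray_box n v : measurable (@box R n (fun=> `[v, +oo[%classic)).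
Proof. exact: measurable_box. Qed.

(** A path whose density with respect to the absorbed kernel is positive has all
    its inner nodes above v. *)
Lemma absorbed_mass_le_grid n h v (A : set (n.-tuple R)) :
  (forall j, 0 < h j) -> elapsed h n.+1 = t -> measurable A ->
  (absorbed_mass v h A <= (heat t u c)%:E *
    P ([set w | A (sample Xf n (elapsed h) w)] `&` grid_above n h v))%E.
Proof.
move=> h0 ht mA; rewrite grid_aboveE.
have mAb := measurableI _ _ mA (measurable_ray_box v).
rewrite heat_mass//; apply: ge0_le_lebesgue_intn.
- exact: (measurable_indicM (measurable_path_absorbed _ _) mA).
- exact: (measurable_indicM (measurable_path_heat _) mAb).
- move=> y; rewrite lee_fin mulr_ge0 ?indic_ge0//; exact: path_absorbed_ge0.
- move=> y; rewrite lee_fin indicI /=.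
  have [yb|yb] := pselect (box (fun=> `[v, +oo[%classic) y).
    rewrite [X in _ <= _ * X * _]indicE mem_set// mulr1.
    by rewrite ler_wpM2l ?indic_ge0 ?path_density_absorbed_le.
  suff -> : path_density (absorbed v) h u (rcons y c) = 0.
    by rewrite mulr0 !mulr_ge0 ?indic_ge0 ?path_heat_ge0.
  move/existsNP : yb => [j]; rewrite /= in_itv/= andbT => /negP.
  rewrite -ltNge => yv.
  apply: (@path_density_absorbed_out _ _ _ _ _ (tnth y j)); last exact: ltW.
  by rewrite mem_rcons inE mem_tnth orbT.
Qed.

Lemma grid_le_absorbed_mass n h v (e H : R) (A : set (n.-tuple R)) :
  0 <= e -> v + e <= u -> v + e <= c ->
  (forall j, 0 < h j <= H) -> elapsed h n.+1 = t -> measurable A ->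
  (((1 - expR (- (2 * e ^+ 2 / H))) ^+ n.+1 * heat t u c)%:E *
    P ([set w | A (sample Xf n (elapsed h) w)] `&` grid_above n h (v + e))
    <= absorbed_mass v h A)%E.
Proof.
move=> e0 vu vc hH ht mA; rewrite grid_aboveE.
have h0 j : 0 < h j by have /andP[] := hH j.
have H0 : 0 < H by have /andP[? ?] := hH 0%N; apply: lt_le_trans (h0 0%N) _.
have eH : 0 <= 1 - expR (- (2 * e ^+ 2 / H)).
  rewrite subr_ge0 -[leRHS]expR0 ler_expR oppr_le0.
  by rewrite !mulr_ge0 ?sqr_ge0// invr_ge0 ltW.
have mAb := measurableI _ _ mA (measurable_ray_box (v + e)).
rewrite EFinM -muleA heat_mass// -ge0_lebesgue_intnZl ?exprn_ge0//; last 2 first.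
- exact: (measurable_indicM (measurable_path_heat _) mAb).
- by move=> y; rewrite lee_fin mulr_ge0 ?indic_ge0// path_heat_ge0.
apply: ge0_le_lebesgue_intn.
- apply: emeasurable_funM => //.
  exact: (measurable_indicM (measurable_path_heat _) mAb).
- exact: (measurable_indicM (measurable_path_absorbed _ _) mA).
- move=> y; rewrite -EFinM lee_fin mulr_ge0 ?exprn_ge0//.
  by rewrite mulr_ge0 ?indic_ge0// path_heat_ge0.
- move=> y; rewrite -EFinM lee_fin indicI /=.
  have [yb|yb] := pselect (box (fun=> `[v + e, +oo[%classic) y).
    rewrite [X in _ * (_ * X * _)]indicE mem_set// mulr1 mulrCA.
    rewrite ler_wpM2l ?indic_ge0//.
    have := @path_density_absorbed_ge R v e H h u (rcons y c) e0 hH.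
    rewrite size_rcons size_tuple; apply.
    rewrite /= vu all_rcons vc/=; apply/allP => b /tnthP[j ->].
    by have := yb j; rewrite /= in_itv/= andbT.
  rewrite [X in _ * (_ * X * _)]indicE memNset// mulr0 mul0r mulr0.
  by rewrite mulr_ge0 ?indic_ge0 ?path_absorbed_ge0.
Qed.

Lemma measurable_grid_above n h v : measurable (grid_above n h v).
Proof.
have := grid_aboveE h v (setT : set (n.-tuple R)).
rewrite setTI (_ : [set w | setT _] `&` _ = grid_above n h v).
  by move=> ->; apply: measurable_sample_set; exact: measurable_ray_box.
by apply/seteqP; split => w // [].
Qed.

End excursion_mass.

(** * Passage to the limit along refined grids *)

Section elementary_bounds.
Context {R : realType}.

Lemma bernoulli_ineq (x : R) N : 0 <= x <= 1 ->
  1 - N%:R * x <= (1 - x) ^+ N.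
Proof.
move=> /andP[x0 x1]; elim: N => [|N IHN]; first by rewrite mul0r subr0 expr0.
rewrite exprS; apply: (@le_trans _ _ ((1 - x) * (1 - N%:R * x))); last first.
  by rewrite ler_wpM2l// subr_ge0.
have : 0 <= N%:R * (x * x) by rewrite !mulr_ge0.
rewrite -natr1; nra.
Qed.

(** Decay faster than 1 / z is needed: the number of steps of a refined grid is
    inversely proportional to their length. *)
Lemma expRN_le (z : R) : 0 < z -> expR (- z) <= 2 / z ^+ 2.
Proof.
move=> z0; rewrite expRN -[leRHS]invrK invf_div lef_pV2 ?posrE ?expR_gt0//.
  by have := expR_ge1Dxn 1 (ltW z0); apply: le_trans; rewrite lerDr.
by rewrite divr_gt0// exprn_gt0.
Qed.

Lemma le_of_dyadic_le (K r M : R) :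
  (forall m : nat, (1 - K / 2 ^+ m) * r <= M) -> r <= M.
Proof.
move=> H; rewrite leNgt; apply/negP => Mr.
pose m := (Num.truncn (K * r / (r - M))).+1.
have Hm : K * r / (r - M) < 2 ^+ m.
  apply: (lt_trans (truncnS_gt _)).
  by rewrite -natrX ltr_nat ltn_expl.
have Hr : K * r / 2 ^+ m < r - M.
  by rewrite ltr_pdivrMr ?exprn_gt0// [ltRHS]mulrC -ltr_pdivrMr// subr_gt0.
have := H m; have -> : (1 - K / 2 ^+ m) * r = r - K * r / 2 ^+ m by ring.
lra.
Qed.

(** The total loss caused by absorption vanishes along the refined grids: there
    are n.+1 * 2 ^ m factors, each of them exponentially close to 1 in 2 ^ m. *)
Lemma exp_power_ge (a : R) n m : 0 < a ->
  1 - 2 * n.+1%:R / a ^+ 2 / 2 ^+ m <=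
  (1 - expR (- (a * 2 ^+ m))) ^+ (n.+1 * 2 ^ m).
Proof.
move=> a0; have a2 : 0 < a * 2 ^+ m by rewrite mulr_gt0// exprn_gt0.
apply: le_trans (bernoulli_ineq _ _); last first.
  by rewrite expR_ge0 -[leRHS]expR0 ler_expR oppr_le0 ltW.
rewrite lerB//; apply: (@le_trans _ _ ((n.+1 * 2 ^ m)%:R * (2 / (a * 2 ^+ m) ^+ 2))).
  by rewrite ler_wpM2l// expRN_le.
rewrite natrM natrX le_eqVlt; apply/orP; left; apply/eqP.
by field; rewrite !gt_eqF// exprn_gt0.
Qed.

End elementary_bounds.

Section excursion_limit.
Context {R : realType} (u c t : R).
Context d (T : measurableType d) (P : probability T R).
Variable X : R -> {RV P >-> R}.
Local Notation Xf := (fun r => X r : T -> R).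
Implicit Types (h : nat -> R) (v : R).

Hypothesis t0 : 0 < t.
Hypothesis law : forall n h (A : set (n.-tuple R)),
  (forall j, 0 < h j) -> elapsed h n.+1 = t -> measurable A ->
  P [set w | A (sample Xf n (elapsed h) w)] =
  lebesgue_intn (fun y => (\1_A y *
    (path_density heat h u (rcons y c) / heat t u c))%:E).
Hypothesis cX : forall w, {within `[0, t], continuous (fun s : R => X s w)}.

Definition grids_above n h v : set T :=
  \bigcap_m grid_above X (refine_size m n) (refine m h) v.

Lemma measurable_grids_above n h v : measurable (grids_above n h v).
Proof.
by apply: bigcapT_measurable => m; exact: measurable_grid_above.
Qed.

Lemma sample_refine_setE n h (A : set (n.-tuple R)) m :
  [set w | A (sample Xf n (elapsed h) w)] =
  [set w | refine_set m A
    (sample Xf (refine_size m n) (elapsed (refine m h)) w)].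
Proof. by apply/seteqP; split => w /= H; apply/(sample_refine Xf m h A w). Qed.

(** The right-hand side does not depend on the grid on which it is computed, while
    the factor of the one-grid bound tends to 1 under refinement. *)
Lemma grids_le_absorbed_mass n h v (e H : R) (A : set (n.-tuple R)) :
  0 < e -> v + e <= u -> v + e <= c ->
  (forall j, 0 < h j <= H) -> elapsed h n.+1 = t -> measurable A ->
  ((heat t u c)%:E *
    P ([set w | A (sample Xf n (elapsed h) w)] `&` grids_above n h (v + e))
    <= absorbed_mass u c v h A)%E.
Proof.
move=> e0 vu vc hH ht mA.
have h0 j : 0 < h j by have /andP[] := hH j.
have H0 : 0 < H by have /andP[? ?] := hH 0%N; apply: lt_le_trans (h0 0%N) _.
have a0 : 0 < 2 * e ^+ 2 / H by rewrite divr_gt0// mulr_gt0// exprn_gt0.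
set S := [set w | _]; set E := grids_above _ _ _.
have mS : measurable S by exact: measurable_sample_set.
have mE : measurable E by exact: measurable_grids_above.
have Hm m : (((1 - expR (- (2 * e ^+ 2 / H * 2 ^+ m))) ^+ (n.+1 * 2 ^ m) *
    heat t u c)%:E * P (S `&` E) <= absorbed_mass u c v h A)%E.
  have hHm j : 0 < refine m h j <= H / 2 ^+ m.
    rewrite refine_gt0//=; apply: refine_le => i.
    by have /andP[] := hH i.
  have := grid_le_absorbed_mass t0 law (ltW e0) vu vc hHm _
    (@measurable_refine_set R m n A mA).
  rewrite elapsed_refine absorbed_mass_refine// => /(_ ht).
  have -> : 2 * e ^+ 2 / (H / 2 ^+ m) = 2 * e ^+ 2 / H * 2 ^+ m.
    by rewrite invf_div mulrA mulrAC.
  rewrite -sample_refine_setE refine_sizeS; apply: le_trans.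
  apply: lee_wpmul2l.
    rewrite lee_fin mulr_ge0 ?heat_ge0// exprn_ge0// subr_ge0.
    by rewrite -[leRHS]expR0 ler_expR oppr_le0 mulr_ge0 ?exprn_ge0// ltW.
  apply: le_measure; rewrite ?inE; first exact: measurableI.
    by apply: measurableI => //; exact: measurable_grid_above.
  by apply: setIS => w; apply.
have [->|Mfin] := eqVneq (absorbed_mass u c v h A) +oo%E; first exact: leey.
have M0 : (0 <= absorbed_mass u c v h A)%E.
  apply: lebesgue_intn_ge0 => y.
  rewrite lee_fin; apply: mulr_ge0; first exact: indic_ge0.
  exact: path_absorbed_ge0.
have Mf : absorbed_mass u c v h A \is a fin_num.
  by rewrite ge0_fin_numE// lt_neqAle Mfin leey.
have Pf : P (S `&` E) \is a fin_num.
  by apply: fin_num_measure; exact: measurableI.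
rewrite -(fineK Mf) -(fineK Pf) -EFinM lee_fin.
apply: (@le_of_dyadic_le _ (2 * n.+1%:R / (2 * e ^+ 2 / H) ^+ 2)) => m.
have := Hm m; rewrite -{1}(fineK Mf) -{1}(fineK Pf) -EFinM lee_fin -[_ * _ * fine _]mulrA.
apply: le_trans; apply: ler_wpM2r.
  by rewrite mulr_ge0 ?heat_ge0// fine_ge0.
exact: exp_power_ge.
Qed.

(** The refined grids are nested, so that the one-grid bound passes to the
    intersection by continuity from above. *)
Lemma absorbed_mass_le_grids n h v (A : set (n.-tuple R)) :
  (forall j, 0 < h j) -> elapsed h n.+1 = t -> measurable A ->
  (absorbed_mass u c v h A <= (heat t u c)%:E *
    P ([set w | A (sample Xf n (elapsed h) w)] `&` grids_above n h v))%E.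
Proof.
move=> h0 ht mA.
set S := [set w | _].
have mS : measurable S by exact: measurable_sample_set.
pose F m := S `&` grid_above X (refine_size m n) (refine m h) v.
have mF m : measurable (F m).
  by apply: measurableI => //; exact: measurable_grid_above.
have FE : S `&` grids_above n h v = \bigcap_m F m.
  apply/seteqP; split => [w [Sw Ew] m _|w Fw].
    by split => //; exact: Ew.
  by split; [case: (Fw 0%N I)|move=> m _; case: (Fw m I)].
have Fcvg : P (F m) @[m --> \oo] --> P (\bigcap_m F m).
  apply: nonincreasing_cvg_mu => //.
  - by rewrite (le_lt_trans (probability_le1 _ _)) ?ltry.
  - exact: bigcapT_measurable.
  - apply/nonincreasing_seqP => m; apply/subsetPset; apply: setIS => w /= Gw j jm.
    have := Gw j.*2.+1; rewrite -doubleS elapsed_halve_steps; apply.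
    by rewrite ltnS ltn_double.
rewrite FE.
have Hcvg : ((heat t u c)%:E * P (F m))%E @[m --> \oo] -->
   ((heat t u c)%:E * P (\bigcap_m F m))%E by exact: cvgeZl.
rewrite -(cvg_lim _ Hcvg)//; apply: lime_ge; first by apply/cvg_ex; eexists; exact: Hcvg.
apply: nearW => m; rewrite /F.
rewrite -(absorbed_mass_refine _ _ _ m h0 mA) /S (sample_refine_setE _ _ m).
apply: absorbed_mass_le_grid => //.
- exact: refine_gt0.
- by rewrite elapsed_refine.
- exact: measurable_refine_set.
Qed.

(** The reflection principle for the bridge: the barriers v + e k decrease to v,
    and both one-sided bounds converge to the mass with absorption at v. *)
Lemma excursion_mass n h v (H : R) (A : set (n.-tuple R)) :
  v < u -> v < c ->
  (forall j, 0 < h j <= H) -> elapsed h n.+1 = t -> measurable A ->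
  ((heat t u c)%:E *
    P ([set w | A (sample Xf n (elapsed h) w)] `&` above Xf v t))%E
  = absorbed_mass u c v h A.
Proof.
move=> vu vc hH ht mA.
have h0 j : 0 < h j by have /andP[] := hH j.
(* The margins e k are at most e0, so that both endpoints are above v + e k. *)
pose e0 : R := Num.min (u - v) (c - v).
have e00 : 0 < e0 by rewrite lt_min !subr_gt0 vu.
pose e (k : nat) : R := e0 * k.+1%:R^-1.
have e_gt0 k : 0 < e k by rewrite mulr_gt0// invr_gt0.
have e_le k : e k <= e0 by apply: ler_piMr; [exact: ltW|rewrite invf_le1// ler1n].
have e_dec : nonincreasing_seq e.
  by move=> i j ij; apply: ler_wpM2l; [exact: ltW|rewrite lef_pV2 ?posrE// ler_nat].
have e_cvg : e k @[k --> \oo] --> 0.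
  rewrite -[X in _ --> X](mulr0 e0); apply: cvgM; first exact: cvg_cst.
  exact: cvg_harmonic.
set S := [set w | _].
have mS : measurable S by exact: measurable_sample_set.
pose F k := S `&` grids_above n h (v + e k).
have mF k : measurable (F k).
  by apply: measurableI => //; exact: measurable_grids_above.
have FE : S `&` above Xf v t = \bigcup_k F k.
  rewrite -setI_bigcupr; congr (_ `&` _); apply/seteqP; split => w /=.
    move=> /(path_min_gtP v hH ht (@cX w) e_gt0 e_cvg)[k xk].
    by exists k => // m _ j jm; exact: xk.
  move=> [k _ xk]; apply/(path_min_gtP v hH ht (@cX w) e_gt0 e_cvg).
  by exists k => m j jm; exact: xk.
have mU : measurable (\bigcup_k F k) by exact: bigcupT_measurable.
have Fcvg : P (F k) @[k --> \oo] --> P (\bigcup_k F k).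
  apply: nondecreasing_cvg_mu => //.
  move=> i j ij; apply/subsetPset; apply: setIS => w Gw m _ l lm.
  by apply: le_trans (Gw m I l lm); rewrite lerD2l e_dec.
have Hcvg : ((heat t u c)%:E * P (F m))%E @[m --> \oo] -->
   ((heat t u c)%:E * P (\bigcup_m F m))%E by exact: cvgeZl.
(* The paths in F k stay at least e k above v, so that the upper bound with
   absorption at v itself applies for every k. *)
rewrite FE; apply/eqP; rewrite eq_le; apply/andP; split.
  rewrite -(cvg_lim _ Hcvg)//; apply: lime_le; first by apply/cvg_ex; eexists; exact: Hcvg.
  apply: nearW => k; apply: (grids_le_absorbed_mass (H := H)) => //.
    by have := e_le k; rewrite le_min => /andP[? _]; rewrite -lerBrDl.
  by have := e_le k; rewrite le_min => /andP[_ ?]; rewrite -lerBrDl.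
have Mcvg := @cvg_absorbed_mass R u c e v n h A h0 mA e_dec e_cvg.
rewrite -(cvg_lim _ Mcvg)//; apply: lime_le; first by apply/cvg_ex; eexists; exact: Mcvg.
apply: nearW => k; apply: (le_trans (absorbed_mass_le_grids _ h0 ht mA)).
apply: lee_wpmul2l; first by rewrite lee_fin heat_ge0.
apply: le_measure; rewrite ?inE//; first exact: mF.
by move=> w Fw; exists k.
Qed.

Lemma measurable_above v : measurable (above Xf v t).
Proof.
pose e (k : nat) : R := k.+1%:R^-1.
have e_gt0 k : 0 < e k by rewrite invr_gt0.
have e_cvg : e k @[k --> \oo] --> 0 by exact: cvg_harmonic.
have hH (j : nat) : 0 < (fun=> t) j <= t by rewrite t0 lexx.
have ht : elapsed (fun=> t) 1 = t by rewrite elapsedS elapsed0 add0r.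
rewrite (_ : above Xf v t = \bigcup_k grids_above 0 (fun=> t) (v + e k)).
  by apply: bigcupT_measurable => k; exact: measurable_grids_above.
apply/seteqP; split => w /=.
  move=> /(path_min_gtP v hH ht (@cX w) e_gt0 e_cvg)[k xk].
  by exists k => // m _ j jm; exact: xk.
move=> [k _ xk]; apply/(path_min_gtP v hH ht (@cX w) e_gt0 e_cvg).
by exists k => m j jm; exact: xk.
Qed.

End excursion_limit.

(** * The conditional density *)

Section time_grids.
Context {R : realType}.

(** Beyond the last step the value t - s n is repeated, so that all durations are
    positive. *)
Definition steps (n : nat) (s : nat -> R) (t : R) : nat -> R :=
  fun j => if (j < n)%N then s j.+1 - s j else t - s n.

Variables (n : nat) (s : nat -> R) (t : R).
Hypothesis grid : time_grid n s t.

Lemma steps_gt0 j : 0 < steps n s t j.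
Proof.
case: grid => _ sinc snt; rewrite /steps.
by case: ifP => [/sinc|_]; rewrite subr_gt0.
Qed.

Lemma elapsed_steps j : (j <= n)%N -> elapsed (steps n s t) j = s j.
Proof.
elim: j => [|j IHj] jn; first by rewrite elapsed0; case: grid.
by rewrite elapsedS (IHj (ltnW jn)) {1}/steps jn; ring.
Qed.

Lemma elapsed_steps_end : elapsed (steps n s t) n.+1 = t.
Proof. by rewrite elapsedS elapsed_steps// {1}/steps ltnn; ring. Qed.

Lemma steps_le j : steps n s t j <= t.
Proof.
have h0 := steps_gt0.
have H i : (i <= n)%N -> steps n s t i <= t.
  move=> lein; rewrite -[leRHS]elapsed_steps_end.
  apply: (@le_trans _ _ (elapsed (steps n s t) i.+1)); last exact: elapsed_le.
  by rewrite elapsedS lerDr elapsed_ge0.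
have [|nj] := leqP j n; first exact: H.
rewrite /steps ltnNge ltnW//=; have := H n (leqnn n).
by rewrite /steps ltnn.
Qed.

Lemma sample_steps T (X : R -> T -> R) w :
  sample X n s w = sample X n (elapsed (steps n s t)) w.
Proof.
by apply: eq_from_tnth => j; rewrite !tnth_mktuple elapsed_steps.
Qed.

End time_grids.

Section densities.
Context {R : realType}.

Lemma path_density_rconsE k h (x z : R) y :
  path_density k h x (rcons y z) =
  (\prod_(j < size y) k (h j) (nth 0 (x :: y) j) (nth 0 (x :: y) j.+1)) *
  k (h (size y)) (nth 0 (x :: y) (size y)) z.
Proof.
elim: y h x => [|y1 y IHy] h x; first by rewrite big_ord0 /= mulr1 mul1r.
by rewrite big_ord_recl [LHS]/= IHy /= mulrA.
Qed.

Lemma excursion_densityE v u c t n s (y : n.-tuple R) :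
  time_grid n s t -> v < u -> v < c -> (forall j, v < tnth y j) ->
  excursion_density v u c t s y =
  path_density (absorbed v) (steps n s t) u (rcons y c) /
  killed_density v t u c.
Proof.
move=> grid vu vc vy.
have vuy j : (j <= n)%N -> v <= nth 0 (u :: y) j.
  case: j => [|j] jn /=; first exact: ltW.
  by have := vy (Ordinal jn); rewrite (tnth_nth 0) => /ltW.
have h0 := steps_gt0 grid.
rewrite path_density_rconsE size_tuple /excursion_density.
congr (_ * _ / _).
  apply: eq_bigr => j _.
  rewrite absorbedE ?vuy//; last by rewrite ltnW.
  by rewrite /steps ltn_ord.
by rewrite absorbedE ?vuy ?ltW// /steps ltnn.
Qed.

Lemma killed_density_gt0 v t u c : 0 < t -> v < u -> v < c ->
  0 < killed_density v t u c :> R.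
Proof.
move=> t0 vu vc; rewrite -absorbedE ?ltW// mulr_gt0 ?heat_gt0//.
rewrite subr_gt0 -[ltRHS]expR0 ltr_expR oppr_lt0.
by rewrite !max_l ?subr_ge0 ?ltW// divr_gt0// !mulr_gt0// subr_gt0.
Qed.

End densities.

Section conditioned_bridge.
Context {R : realType} d (T : measurableType d) (P : probability T R)
  (B : R -> {RV P >-> R}) (hB : standard_brownian B)
  (mu v u c t : R) (hu : v < u) (hc : v < c) (ht : 0 < t).
Context d1 (T1 : measurableType d1) (P1 : probability T1 R)
  (X : R -> {RV P1 >-> R}).
Hypothesis hX : is_bridge P (drifted B mu u) u t c X.
Local Notation Xf := (fun r => X r : T1 -> R).

(** The right-hand side does not involve mu; this is the source of the equality in
    law. *)
Lemma bridge_above_mass n s (A : set (n.-tuple R)) :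
  time_grid n s t -> measurable A ->
  ((heat t u c)%:E * P1 ([set w | A (sample Xf n s w)] `&` above Xf v t) =
   absorbed_mass u c v (steps n s t) A)%E.
Proof.
move=> grid mA.
rewrite -(@excursion_mass R u c t d1 T1 P1 X ht _ _ n (steps n s t) v t A)//.
- congr (_ * P1 (_ `&` _))%E; apply/seteqP; split => w /=;
  by rewrite (sample_steps grid).
- by move=> m h A' h0 hend mA'; exact: (bridge_law hB hX).
- exact: (bridge_continuous hX).
- by move=> j; rewrite steps_gt0// steps_le.
- exact: elapsed_steps_end.
Qed.

(** The grid without inner nodes gives the probability of the conditioning
    event. *)
Lemma bridge_above : ((heat t u c)%:E * P1 (above Xf v t) =
  (killed_density v t u c)%:E)%E.
Proof.
have grid : time_grid 0 (fun=> 0) t by split.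
have := bridge_above_mass grid (measurableT : measurable (setT : set (0.-tuple R))).
rewrite (_ : [set w | setT _] `&` above Xf v t = above Xf v t); last first.
  by apply/seteqP; split => w // [].
move=> ->; rewrite /absorbed_mass /= indicT mul1r mulr1 /steps /= subr0.
by rewrite absorbedE// ltW.
Qed.

Lemma bridge_excursion_density n s (A : set (n.-tuple R)) :
  time_grid n s t -> measurable A ->
  (forall y, A y -> forall j : 'I_n, v < tnth y j) ->
  (conditional_prob P1 [set w | A (sample Xf n s w)] (above Xf v t))%:E =
  lebesgue_intn (fun y : n.-tuple R =>
    (\1_A y * excursion_density v u c t s y)%:E).
Proof.
move=> grid mA Av.
have h0 := steps_gt0 grid.
have k0 := killed_density_gt0 ht hu hc.
rewrite (eq_lebesgue_intn (g := fun y => ((killed_density v t u c)^-1%:E *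
    (\1_A y * path_density (absorbed v) (steps n s t) u (rcons y c))%:E)%E)); last first.
  move=> y; rewrite -EFinM; congr EFin.
  have [Ay|nAy] := pselect (A y).
    by rewrite excursion_densityE//; [ring|exact: Av].
  by rewrite indicE memNset// !mul0r mulr0.
rewrite ge0_lebesgue_intnZl; last 3 first.
- by rewrite invr_ge0 ltW.
- exact: (measurable_indicM (measurable_path_absorbed _ _ _ _) mA).
- move=> y; rewrite lee_fin mulr_ge0 ?indic_ge0//; exact: path_absorbed_ge0.
rewrite -[lebesgue_intn _]/(absorbed_mass u c v (steps n s t) A).
rewrite -bridge_above_mass//; have := bridge_above.
have mE : measurable (above Xf v t) := measurable_above ht (bridge_continuous hX) v.
have mS : measurable [set w | A (sample Xf n s w)] by exact: measurable_sample_set.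
have pf (S : set T1) : measurable S -> P1 S = (fine (P1 S))%:E.
  by move=> mS'; rewrite fineK// fin_num_measure.
rewrite /conditional_prob (pf _ mE) (pf _ (measurableI _ _ mS mE)) -!EFinM.
move=> [kE]; congr EFin; move: kE k0; rewrite /=.
set p := heat t u c; set a := fine _; set b := fine _ => <- pa.
have p0 : 0 < p by exact: heat_gt0.
have a0 : a != 0 by apply: contraTneq pa => ->; rewrite mulr0 ltxx.
by field; rewrite a0 gt_eqF.
Qed.

End conditioned_bridge.

(** * Equality in law *)

Section cylinders.
Context {R : realType} (u c t : R) (ht : 0 < t).

Definition cylinder (S : seq R) (C : R -> set R) : set (R -> R) :=
  [set x | forall s, s \in S -> C s (x s)].

Definition cylinders : set (set (R -> R)) :=
  [set A | exists (S : seq R) (C : R -> set R),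
     [/\ forall s, s \in S -> 0 <= s <= t, forall s, measurable (C s) &
         A = cylinder S C]].

Lemma setI_closed_cylinders : setI_closed cylinders.
Proof.
move=> _ _ [S [C [St mC ->]]] [S' [C' [St' mC' ->]]].
exists (S ++ S'), (fun s => (if s \in S then C s else setT) `&`
  (if s \in S' then C' s else setT)); split.
- by move=> s; rewrite mem_cat => /orP[/St|/St'].
- by move=> s; apply: measurableI; case: ifP.
- apply/seteqP; split => x /=.
    move=> [H H'] s _; split; case: ifP => // sS; [exact: H|exact: H'].
  move=> H; split => s sS.
    by have := H s; rewrite mem_cat sS => /(_ isT)[].
  by have := H s; rewrite mem_cat sS orbT => /(_ isT)[].
Qed.

Lemma path_events_sub_cylinders : path_events t `<=` <<s cylinders >>.
Proof.
apply: smallest_sub; first exact: smallest_sigma_algebra.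
move=> _ [s [C [st mC ->]]]; apply: sub_sigma_algebra.
exists [:: s], (fun=> C); split => //.
  by move=> s'; rewrite inE => /eqP ->.
apply/seteqP; split => x /=; first by move=> Cx s'; rewrite inE => /eqP ->.
by apply; rewrite inE.
Qed.

Definition inner_times (S : seq R) : seq R :=
  sort <=%R (undup [seq s <- S | 0 < s < t]).

(** The default value t makes the node after the last inner time the end of the
    interval. *)
Definition inner_grid (S : seq R) (j : nat) : R :=
  nth t (0 :: inner_times S) j.

Lemma mem_inner_times S s : (s \in inner_times S) = (s \in S) && (0 < s < t).
Proof. by rewrite mem_sort mem_undup mem_filter andbC. Qed.

Lemma inner_times_bounds S j : (j < size (inner_times S))%N ->
  0 < nth t (inner_times S) j < t.
Proof. by move=> /(mem_nth t); rewrite mem_inner_times => /andP[]. Qed.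

Lemma time_grid_inner (S : seq R) :
  time_grid (size (inner_times S)) (inner_grid S) t.
Proof.
split => // [j jS|].
  rewrite /inner_grid.
  have : sorted <%R (0 :: inner_times S).
    rewrite /= (path_sortedE lt_trans); apply/andP; split.
      by apply/allP => s; rewrite mem_inner_times => /andP[_ /andP[]].
    by rewrite sort_lt_sorted undup_uniq.
  by move=> /(sortedP t); apply.
rewrite /inner_grid; case: (size _) (@inner_times_bounds S) => [//|m] /=.
by move=> /(_ m (leqnn _)) /andP[].
Qed.

(** The values of a bridge at the times 0 and t are deterministic, so the
    constraints of a cylinder at these times become conditions on u and c. *)
Definition cylinder_set (S : seq R) (C : R -> set R) :
    set ((size (inner_times S)).-tuple R) :=
  [set y | [/\ 0 \in S -> C 0 u, t \in S -> C t c &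
    box (fun j => C (inner_grid S j.+1)) y]].

Lemma measurable_cylinder_set (S : seq R) (C : R -> set R) :
  (forall s, measurable (C s)) -> measurable (@cylinder_set S C).
Proof.
move=> mC; have mbox : measurable
    (@box R (size (inner_times S)) (fun j => C (inner_grid S j.+1))).
  exact: measurable_box.
have [H|H] := pselect ((0 \in S -> C 0 u) /\ (t \in S -> C t c)).
  rewrite (_ : @cylinder_set S C = box (fun j => C (inner_grid S j.+1)))//.
  by case: H => H0 Ht; apply/seteqP; split => y // [].
rewrite (_ : @cylinder_set S C = set0)//.
by apply/seteqP; split => y // [? ? _]; exact: H.
Qed.

(** A single path is viewed as a process on the one-point space, to which the
    notion of sample applies. *)
Lemma cylinder_sample (S : seq R) (C : R -> set R) (x : R -> R) :
  (forall s, s \in S -> 0 <= s <= t) -> x 0 = u -> x t = c ->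
  cylinder S C x <->
  cylinder_set C (sample (fun r (_ : unit) => x r) (size (inner_times S))
    (inner_grid S) tt).
Proof.
move=> St x0 xt; split => [H|[H0 Ht H]].
- split; [by move=> /H; rewrite x0|by move=> /H; rewrite xt|].
  move=> j; rewrite tnth_mktuple; apply: H.
  have : nth t (inner_times S) j \in inner_times S by exact: mem_nth.
  by rewrite mem_inner_times => /andP[].
- move=> s sS; have /andP[] := St s sS.
  rewrite le_eqVlt => /predU1P[s0|s0]; first by move: sS; rewrite -s0 x0 => S0 _; exact: H0.
  rewrite le_eqVlt => /predU1P[st|st]; first by move: sS; rewrite st xt => St'; exact: Ht.
  have sI : s \in inner_times S by rewrite mem_inner_times sS s0.
  have lt_s : (index s (inner_times S) < size (inner_times S))%N by rewrite index_mem.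
  have := H (Ordinal lt_s); rewrite tnth_mktuple /inner_grid /=.
  by rewrite nth_index.
Qed.

End cylinders.

Section equality_in_law.
Context {R : realType} d (T : measurableType d) (P : probability T R)
  (B : R -> {RV P >-> R}) (hB : standard_brownian B)
  (v u c t : R) (hu : v < u) (hc : v < c) (ht : 0 < t).

Lemma cylinder_above_mass (mu : R) d1 (T1 : measurableType d1)
    (P1 : probability T1 R) (X : R -> {RV P1 >-> R}) (S : seq R) (C : R -> set R) :
  is_bridge P (drifted B mu u) u t c X ->
  (forall s, s \in S -> 0 <= s <= t) -> (forall s, measurable (C s)) ->
  let A := [set w | cylinder S C (fun s => X s w)] in
  measurable A /\
  ((heat t u c)%:E * P1 (A `&` above (fun r => X r : T1 -> R) v t) =
   absorbed_mass u c v (steps (size (inner_times t S)) (inner_grid t S) t)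
     (@cylinder_set R u c t S C))%E.
Proof.
move=> hX St mC A.
have mA : measurable A.
  rewrite (_ : A = \bigcap_(s in [set` S]) (X s @^-1` C s)); last first.
    by apply/seteqP; split => w H s /H.
  apply: fin_bigcap_measurable; first exact: finite_seq.
  by move=> s _; rewrite -[X in measurable X]setTI; exact: measurable_funPT.
split => //.
have mD := @measurable_cylinder_set R u c t S C mC.
rewrite -(bridge_above_mass hB hu hc ht hX (time_grid_inner ht S) mD).
have mE := measurable_above ht (bridge_continuous hX) v.
congr (_ * _)%E; apply: eq_measure_ae.
- exact: measurableI.
- by apply: measurableI => //; exact: measurable_sample_set.
- apply: filterS2 (bridge_start hX) (bridge_end hX) => w X0 Xt.
  have := @cylinder_sample R u c t S C (fun s => X s w) St X0 Xt.
  by rewrite /= => H; split => -[Aw Ew]; split => //; exact/H.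
Qed.

Lemma bridges_eq_in_law (mu1 mu2 : R) d1 (T1 : measurableType d1)
    (P1 : probability T1 R) (X : R -> {RV P1 >-> R})
    d2 (T2 : measurableType d2) (P2 : probability T2 R)
    (Y : R -> {RV P2 >-> R}) (A : set (R -> R)) :
  is_bridge P (drifted B mu1 u) u t c X ->
  is_bridge P (drifted B mu2 u) u t c Y ->
  path_events t A ->
  conditional_law P1 (fun r => X r : T1 -> R)
    (above (fun r => X r : T1 -> R) v t) A =
  conditional_law P2 (fun r => Y r : T2 -> R)
    (above (fun r => Y r : T2 -> R) v t) A.
Proof.
move=> hX hY /path_events_sub_cylinders cA.
set EX := above (fun r => X r : T1 -> R) v t.
set EY := above (fun r => Y r : T2 -> R) v t.
have mEX : measurable EX := measurable_above ht (bridge_continuous hX) v.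
have mEY : measurable EY := measurable_above ht (bridge_continuous hY) v.
pose AX (A : set (R -> R)) := [set w | A (fun s => X s w)].
pose AY (A : set (R -> R)) := [set w | A (fun s => Y s w)].
have p0 := heat_gt0 u c ht.
have heat_inj (a b : \bar R) :
    ((heat t u c)%:E * a = (heat t u c)%:E * b)%E -> a = b.
  move=> /(congr1 (fun z => ((heat t u c)^-1)%:E * z)%E).
  by rewrite !muleA -EFinM mulVf ?gt_eqF// !mul1e.
have EXY : P1 EX = P2 EY.
  by apply: heat_inj; rewrite (bridge_above hB hu hc ht hX) (bridge_above hB hu hc ht hY).
(* The Dynkin system to which the pi-lambda theorem is applied. *)
pose H := [set A | [/\ measurable (AX A), measurable (AY A) &
  P1 (AX A `&` EX) = P2 (AY A `&` EY)]].
suff : H A by move=> [_ _ HA]; rewrite /conditional_law /conditional_prob HA EXY.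
have dH : dynkin H.
  split.
  - have AXT : AX setT = setT by apply/seteqP; split.
    have AYT : AY setT = setT by apply/seteqP; split.
    by split; rewrite ?AXT ?AYT ?setTI.
  - move=> D [mX mY XY]; split; [exact: measurableC|exact: measurableC|].
    have -> : AX (~` D) `&` EX = EX `\` (AX D `&` EX).
      by rewrite setDIr setDv setU0 setIC.
    have -> : AY (~` D) `&` EY = EY `\` (AY D `&` EY).
      by rewrite setDIr setDv setU0 setIC.
    rewrite !measureD//; [|exact: measurableI|by rewrite ltey_eq fin_num_measure
      |exact: measurableI|by rewrite ltey_eq fin_num_measure].
    rewrite (setICA EX (AX D)) (setICA EY (AY D)) !setIid.
    by apply: (congr2 (fun a b => a - b)%E).
  - move=> F tF HF.
    have AXb : AX (\bigcup_k F k) `&` EX = \bigcup_k (AX (F k) `&` EX).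
      by rewrite -setI_bigcupl.
    have AYb : AY (\bigcup_k F k) `&` EY = \bigcup_k (AY (F k) `&` EY).
      by rewrite -setI_bigcupl.
    split.
    + by apply: bigcupT_measurable => k; case: (HF k).
    + by apply: bigcupT_measurable => k; case: (HF k).
    + rewrite AXb AYb !measure_bigcup//=.
      * by apply: eq_eseriesr => k _; case: (HF k).
      * by move=> k _; apply: measurableI => //; case: (HF k).
      * apply/trivIsetP => i j _ _ ij.
        move/trivIsetP : tF => /(_ i j I I ij) Fij.
        apply/seteqP; split => w // [[Fi _] [Fj _]].
        by rewrite -[set0 w]/(set0 (fun s => Y s w)) -Fij.
      * by move=> k _; apply: measurableI => //; case: (HF k).
      * apply/trivIsetP => i j _ _ ij.
        move/trivIsetP : tF => /(_ i j I I ij) Fij.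
        apply/seteqP; split => w // [[Fi _] [Fj _]].
        by rewrite -[set0 w]/(set0 (fun s => X s w)) -Fij.
apply: (lambda_system_subset (@setI_closed_cylinders R t)
  ((dynkin_lambda_system H).1 dH) _ _ cA) => //.
move=> _ [S [C [St mC ->]]].
have [mX HX] := cylinder_above_mass hX St mC.
have [mY HY] := cylinder_above_mass hY St mC.
by split => //; apply: heat_inj; rewrite HX HY.
Qed.

End equality_in_law.

Theorem theorem6p1 (R : realType) (d : measure_display) (T : measurableType d)
    (P : probability T R) (B : R -> {RV P >-> R}) (hB : standard_brownian B)
    (mu v u c t : R) (hu : v < u) (hc : v < c) (ht : 0 < t) :
  (forall (d1 : measure_display) (T1 : measurableType d1)
      (P1 : probability T1 R) (X : R -> {RV P1 >-> R}),
    is_bridge P (drifted B mu u) u t c X ->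
    forall (n : nat) (s : nat -> R), (1 <= n)%N -> time_grid n s t ->
    forall A : set (n.-tuple R), measurable A ->
      (forall y, A y -> forall j : 'I_n, v < tnth y j) ->
      (conditional_prob P1
         [set w | A (sample (fun r => X r : T1 -> R) n s w)]
         (above (fun r => X r : T1 -> R) v t))%:E =
      lebesgue_intn
        (fun y : n.-tuple R => (\1_A y * excursion_density v u c t s y)%:E)) /\
  (forall (d1 : measure_display) (T1 : measurableType d1)
      (P1 : probability T1 R) (X : R -> {RV P1 >-> R})
      (d2 : measure_display) (T2 : measurableType d2)
      (P2 : probability T2 R) (Y : R -> {RV P2 >-> R}),
    is_bridge P (drifted B mu u) u t c X ->
    is_bridge P (drifted B 0 u) u t c Y ->
    forall A : set (R -> R), path_events t A ->
      conditional_law P1 (fun r => X r : T1 -> R)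
        (above (fun r => X r : T1 -> R) v t) A =
      conditional_law P2 (fun r => Y r : T2 -> R)
        (above (fun r => Y r : T2 -> R) v t) A).
Proof.
split.
- move=> d1 T1 P1 X hX n s _ grid A mA Av.
  exact: (bridge_excursion_density hB hu hc ht hX grid mA Av).
- move=> d1 T1 P1 X d2 T2 P2 Y hX hY A tA.
  exact: (bridges_eq_in_law hB hu hc ht hX hY tA).
Qed.
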